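(* Let $1<p,q<\infty$ with $q\neq2$. Then there exists a Calderón–Zygmund operator $T$ on $\mathbb{R}^n$ which is not bounded on $M^{p,q}(\mathbb{R}^n)$, i.e. there is no constant $C$ with $\|Tf\|_{M^{p,q}}\le C\|f\|_{M^{p,q}}$ for all $f\in\mathcal{S}(\mathbb{R}^n)$.
   Context: A Calderón–Zygmund operator is an $L^2(\mathbb{R}^n)$-bounded linear operator whose distributional kernel coincides, outside the diagonal $\{x=y\}$, with a function $K(x,y)$ satisfying, for some $0<\epsilon\le1$ and $C>0$: $|K(x,y)|\le C|x-y|^{-n}$; $|K(x,y)-K(x',y)|\le C|x-x'|^\epsilon|x-y|^{-n-\epsilon}$ for $|x-y|>2|x-x'|$; $|K(x,y)-K(x,y')|\le C|y-y'|^\epsilon|x-y|^{-n-\epsilon}$ for $|x-y|>2|y-y'|$. Modulation spaces: fix a window $\gamma\in\mathcal{S}(\mathbb{R}^n)\setminus\{0\}$, set $V_\gamma f(x,\xi)=(f,M_\xi T_x\gamma)$ with $M_\xi\gamma(t)=e^{i\xi\cdot t}\gamma(t)$, $T_x\gamma(t)=\gamma(t-x)$; $M^{p,q}(\mathbb{R}^n)$ is the set of $f\in\mathcal{S}'(\mathbb{R}^n)$ with $\|f\|_{M^{p,q}}=\|(\int|V_\gamma f(x,\xi)|^pdx)^{1/p}\|_{L^q_\xi}<\infty$. *)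

(* Defs.v *)
From mathcomp Require Import all_boot all_algebra.
From mathcomp Require Import all_classical all_reals all_analysis.
From mathcomp Require Import complex.
Import Num.Theory GRing.Theory numFieldTopology.Exports numFieldNormedType.Exports.

Set Implicit Arguments.
Unset Strict Implicit.
Unset Printing Implicit Defensive.

Local Open Scope classical_set_scope.
Local Open Scope ring_scope.

Definition dotRn (R : realType) (n : nat) (x y : 'rV[R]_n) : R :=
  \sum_(i < n) x 0 i * y 0 i.

Definition enorm (R : realType) (n : nat) (x : 'rV[R]_n) : R :=
  Num.sqrt (\sum_(i < n) x 0 i ^+ 2).

Definition cmod (R : realType) (z : R[i]) : R :=
  Num.sqrt (complex.Re z ^+ 2 + complex.Im z ^+ 2).

Definition expi (R : realType) (t : R) : R[i] := Complex (cos t) (sin t).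

Definition rowOfSeq (R : realType) (n : nat) (s : seq R) : 'rV[R]_n :=
  \row_(i < n) nth 0 s i.

Fixpoint iterint (R : realType) (k : nat) (F : seq R -> \bar R) : \bar R :=
  match k with
  | 0%N => F [::]
  | k'.+1 => (\int[@lebesgue_measure R]_(x in [set: R])
                 iterint k' (fun s => F (x :: s)))%E
  end.

Definition intRn (R : realType) (n : nat) (f : 'rV[R]_n -> \bar R) : \bar R :=
  iterint n (fun s => f (rowOfSeq n s)).

Definition cint (R : realType) (n : nat) (h : 'rV[R]_n -> R[i]) : R[i] :=
  Complex (fine (intRn (fun x => (complex.Re (h x))%:E)))
          (fine (intRn (fun x => (complex.Im (h x))%:E))).

Definition L2sq (R : realType) (n : nat) (f : 'rV[R]_n -> R[i]) : \bar R :=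
  intRn (fun x => (cmod (f x) ^+ 2)%:E).

Definition borel_fun (R : realType) (n : nat) (h : 'rV[R]_n -> R) : Prop :=
  forall U : set R, open U ->
    <<s [set A : set 'rV[R]_n | open A] >> (h @^-1` U).

Definition borel_cfun (R : realType) (n : nat) (h : 'rV[R]_n -> R[i]) : Prop :=
  borel_fun (fun x => complex.Re (h x)) /\ borel_fun (fun x => complex.Im (h x)).

Fixpoint pder (R : realType) (n : nat) (ds : seq 'I_n) (g : 'rV[R]_n -> R)
  : 'rV[R]_n -> R :=
  match ds with
  | [::] => g
  | i :: ds' => fun x => derive (pder ds' g) x (delta_mx 0 i)
  end.

Definition schwartz_real (R : realType) (n : nat) (g : 'rV[R]_n -> R) : Prop :=
  (forall (ds : seq 'I_n) (i : 'I_n) (x : 'rV[R]_n),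
      derivable (pder ds g) x (delta_mx 0 i)) /\
  (forall (ds : seq 'I_n) (N : nat), exists C : R,
      forall x : 'rV[R]_n, (1 + enorm x) ^+ N * `|pder ds g x| <= C).

Definition schwartz (R : realType) (n : nat) (f : 'rV[R]_n -> R[i]) : Prop :=
  schwartz_real (fun x => complex.Re (f x)) /\
  schwartz_real (fun x => complex.Im (f x)).

Definition supp (R : realType) (n : nat) (f : 'rV[R]_n -> R[i]) : set 'rV[R]_n :=
  closure [set x | f x != 0].

Definition test_fun (R : realType) (n : nat) (f : 'rV[R]_n -> R[i]) : Prop :=
  schwartz f /\ compact (supp f).

(* T is given by its action on the Schwartz class S(R^n) (which is dense in L^2,
   so an L^2-bounded linear operator is the same as a linear map on S that is
   bounded for the L^2 norm); T f is a (Borel) function in L^2. *)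
Definition CZ_kernel (R : realType) (n : nat) (K : 'rV[R]_n -> 'rV[R]_n -> R[i])
  (eps C : R) : Prop :=
  [/\ 0 < eps <= 1, 0 < C,
      (forall x y : 'rV[R]_n, x != y ->
         cmod (K x y) <= C / enorm (x - y) ^+ n),
      (forall x x' y : 'rV[R]_n, 2 * enorm (x - x') < enorm (x - y) ->
         cmod (K x y - K x' y)
           <= C * powR (enorm (x - x')) eps / powR (enorm (x - y)) (n%:R + eps)) &
      (forall x y y' : 'rV[R]_n, 2 * enorm (y - y') < enorm (x - y) ->
         cmod (K x y - K x y')
           <= C * powR (enorm (y - y')) eps / powR (enorm (x - y)) (n%:R + eps))].

Definition CZ_operator (R : realType) (n : nat)
  (T : ('rV[R]_n -> R[i]) -> ('rV[R]_n -> R[i])) : Prop :=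
  [/\
      (forall f, schwartz f -> borel_cfun (T f)),
      (forall (a : R[i]) (f g : 'rV[R]_n -> R[i]), schwartz f -> schwartz g ->
         T (fun x => a * f x + g x) = (fun x => a * T f x + T g x)),
      (exists B : R, forall f, schwartz f -> (L2sq (T f) <= (B ^+ 2)%:E * L2sq f)%E) &
      (* the distributional kernel coincides with K off the diagonal *)
      exists (K : 'rV[R]_n -> 'rV[R]_n -> R[i]) (eps C : R),
        CZ_kernel K eps C /\
        forall f g : 'rV[R]_n -> R[i], test_fun f -> test_fun g ->
          supp f `&` supp g = set0 ->
          cint (fun x => T f x * g x) =
          cint (fun x => cint (fun y => K x y * f y) * g x)].

Definition stft (R : realType) (n : nat) (gamma f : 'rV[R]_n -> R[i])
  (x xi : 'rV[R]_n) : R[i] :=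
  cint (fun t => f t * conjc (expi (dotRn xi t) * gamma (t - x))).

Definition modnorm (R : realType) (n : nat) (gamma : 'rV[R]_n -> R[i]) (p q : R)
  (f : 'rV[R]_n -> R[i]) : \bar R :=
  (poweR (intRn (fun xi : 'rV[R]_n =>
            poweR (poweR (intRn (fun x => (powR (cmod (stft gamma f x xi)) p)%:E))
                         p^-1) q))
         q^-1)%E.

(* Main.v *)
Require Import Defs.
From mathcomp Require Import all_boot all_order all_algebra.
From mathcomp Require Import all_classical all_reals all_analysis.
From mathcomp Require Import measurable_realfun complex.
From mathcomp Require Import ring lra.
Import Num.Theory GRing.Theory.
Import Order.TTheory numFieldTopology.Exports numFieldNormedType.Exports.

Set Implicit Arguments.
Unset Strict Implicit.
Unset Printing Implicit Defensive.

Local Open Scope classical_set_scope.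
Local Open Scope ring_scope.

(** Multiplication by a bounded function u(t_0) of the first coordinate is bounded on L^2
    and has distributional kernel 0 off the diagonal, so it suffices to find a continuous u
    with |u| <= 1 that is not a multiplier of M^{p,q}.

    The short-time Fourier transform of a modulated window is a translate, in frequency, of
    Psi = V_gamma gamma, which is nonzero near the origin and decays like
    prod_i (1 + |x_i|)^-2 (1 + |xi_i|)^-1.  A Rudin-Shapiro polynomial Q with N = 2^a widely
    spaced frequencies satisfies |Q| <= 1 and has N coefficients of size about N^(-1/2), so
    the M^{p,q} norm of Q gamma is about N^(1/q - 1/2).  If q < 2 this is unbounded although
    gamma has finite norm.  If q > 2 then conj(Q) gamma has norm tending to 0 while
    Q conj(Q) gamma is gamma / 2 up to high frequencies, hence has norm bounded below.
    Both lower bounds survive the addition of a fixed trigonometric polynomial (if the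
    spacing is large) and of a uniformly small function, so a gliding hump series
    u = sum_k kappa_k Q_k defeats every constant.

    All integrals are iterated one-dimensional ones.  Decay in xi is obtained without
    differentiating under the integral: translating by half a period turns the integral
    into one of a difference, and mixed differences of a Schwartz function are controlled
    by the mean value theorem. *)

(** A sup bound on a multiplier controls only the l^2 size of its Fourier coefficients, whereas
    M^{p,q} measures frequencies in an l^q sense; the two scales agree exactly at q = 2. Flat
    polynomials make the gap visible, since their sup norm is, up to a constant, as small as the l^2
    norm of their coefficients permits. The exponent p enters only through the x-integrals, which
    behave alike for all the functions involved.

    The obstacle is the order of choices: one operator has to be fixed before any constant is given.
    Each hump must work on top of an arbitrary finite sum chosen earlier and survive a remainder
    about which only continuity and a sup bound are known. Such a remainder has no decay in the
    first frequency coordinate, so that coordinate is treated apart from the others. Within a hump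
    the degree is chosen first; coefficient sums then bound all interference independently of the
    spacing, and the spacing, chosen afterwards, suppresses it.

    One difference per coordinate yields first-order decay in frequency, which is not integrable;
    its q-th power is, because q > 1. *)

Section ComplexModulus.
Context {R : realType}.
Implicit Types (z y : R[i]) (t a : R).

Lemma cmod_normc z : cmod z = ComplexField.Normc.normc z.
Proof. by case: z. Qed.

Lemma cmodM z y : cmod (z * y) = cmod z * cmod y.
Proof. by rewrite !cmod_normc ComplexField.Normc.normcM. Qed.

Lemma cmod_leD z y : cmod (z + y) <= cmod z + cmod y.
Proof. by rewrite !cmod_normc le_normcD. Qed.

Lemma cmodN z : cmod (- z) = cmod z.
Proof. by rewrite !cmod_normc normcN. Qed.

Lemma cmod_ge0 z : 0 <= cmod z.
Proof. exact: sqrtr_ge0. Qed.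

Lemma cmod_leB z y : cmod (z - y) <= cmod z + cmod y.
Proof. by rewrite -(cmodN y) cmod_leD. Qed.

Lemma cmod0 : cmod (0 : R[i]) = 0.
Proof. by rewrite cmod_normc ComplexField.Normc.normc0. Qed.

Lemma cmod_conjc z : cmod (conjc z) = cmod z.
Proof. by case: z => a b; rewrite /cmod /= sqrrN. Qed.

Lemma cmod_expi t : cmod (expi t) = 1.
Proof. by rewrite /cmod /= cos2Dsin2 sqrtr1. Qed.

Lemma cmod_sqr z : cmod z ^+ 2 = complex.Re z ^+ 2 + complex.Im z ^+ 2.
Proof. by rewrite sqr_sqrtr // addr_ge0 ?sqr_ge0. Qed.

Lemma ler_sqr_cmod (x : R) z : x ^+ 2 <= cmod z ^+ 2 -> `|x| <= cmod z.
Proof. by rewrite -real_normK ?num_real // ler_pXn2r // ?nnegrE ?cmod_ge0. Qed.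

Lemma normr_Re_le z : `|complex.Re z| <= cmod z.
Proof. by apply: ler_sqr_cmod; rewrite cmod_sqr lerDl sqr_ge0. Qed.

Lemma normr_Im_le z : `|complex.Im z| <= cmod z.
Proof. by apply: ler_sqr_cmod; rewrite cmod_sqr lerDr sqr_ge0. Qed.

Lemma cmod_le_Re_Im z : cmod z <= `|complex.Re z| + `|complex.Im z|.
Proof.
rewrite -(@ler_pXn2r _ 2) // ?nnegrE ?cmod_ge0 ?addr_ge0 // cmod_sqr sqrrD.
rewrite !real_normK ?num_real // -addrA [X in _ <= _ + X]addrC addrA lerDl.
by rewrite mulrn_wge0 // mulr_ge0.
Qed.

Lemma expiD t a : expi (t + a) = expi t * expi a.
Proof.
rewrite /expi cosD sinD; apply/eqP; rewrite eq_complex /= eqxx /=.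
by rewrite addrC (mulrC (sin t)) eqxx.
Qed.

Lemma expi0 : expi (0 : R) = 1.
Proof. by rewrite /expi cos0 sin0. Qed.

Lemma expi_conj t : conjc (expi t) = expi (- t).
Proof. by rewrite /expi /= cosN sinN. Qed.

Lemma expi_pi : expi (pi : R) = -1.
Proof. by rewrite /expi cospi sinpi; apply/eqP; rewrite eq_complex /= oppr0 !eqxx. Qed.

Lemma cmod_real t : cmod (Complex t 0) = `|t|.
Proof. by rewrite /cmod /= expr0n addr0 sqrtr_sqr. Qed.

Lemma cmod_sum (I : Type) (r : seq I) (F : I -> R[i]) :
  cmod (\sum_(i <- r) F i) <= \sum_(i <- r) cmod (F i).
Proof.
elim: r => [|i r ih]; first by rewrite !big_nil cmod0.
by rewrite !big_cons (le_trans (cmod_leD _ _)) // lerD2l.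
Qed.

Lemma cmod_triangleB z y : cmod z - cmod y <= cmod (z + y).
Proof.
by rewrite lerBlDr -{1}(addrK y z) (le_trans (cmod_leB _ _)).
Qed.

End ComplexModulus.

(** * Polynomial weights on the line *)

Section Decay.
Context {R : realType}.
Implicit Types (x y h : R).

Definition decay (k : nat) x : R := ((1 + `|x|) ^+ k)^-1.

Lemma onepnorm_gt0 x : 0 < 1 + `|x|.
Proof. by rewrite ltr_pwDl. Qed.

Lemma decay_gt0 k x : 0 < decay k x.
Proof. by rewrite invr_gt0 exprn_gt0 // onepnorm_gt0. Qed.

Lemma decay_ge0 k x : 0 <= decay k x.
Proof. exact: ltW (decay_gt0 _ _). Qed.

Lemma decay_le1 k x : decay k x <= 1.
Proof. by rewrite invf_le1 ?exprn_ege1 ?lerDl // exprn_gt0 // onepnorm_gt0. Qed.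

Lemma decayD k l x : decay (k + l) x = decay k x * decay l x.
Proof. by rewrite /decay exprD invfM. Qed.

Lemma decay_continuous k : continuous (decay k).
Proof.
move=> x; apply: cvgV; first by rewrite expf_neq0 // gt_eqF // onepnorm_gt0.
apply: (@continuous_comp _ _ _ (fun y : R => 1 + `|y|) (fun z : R => z ^+ k)).
  by apply: cvgD; [exact: cvg_cst|exact: norm_continuous].
exact: exprn_continuous.
Qed.

(** Peetre's inequality, from [1 + |y| <= (1 + |x|) (1 + |x - y|)]. It turns the decay of a product
    of two translates into decay in their displacement. *)
Lemma decay_triangle k x y : decay k x * decay k (x - y) <= decay k y.
Proof.
rewrite -invfM -exprMn lef_pV2 ?posrE ?exprn_gt0 ?mulr_gt0 ?onepnorm_gt0 //.
apply: lerXn2r; rewrite ?nnegrE ?mulr_ge0 ?addr_ge0 //.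
have : `|y| <= `|x| + `|x - y| by rewrite -{1}(subKr x y) ler_normB.
have : 0 <= `|x| * `|x - y| by rewrite mulr_ge0.
lra.
Qed.

(** Here [1 + |x| <= 1 + |x + h| + 4 <= 5 (1 + |x + h|)]. The bound 4 on the step comes from
    [pi <= 4], as the steps used are half periods [pi / xi] with [|xi| >= 1]. *)
Lemma decay_shift k x h : `|h| <= 4 -> decay k (x + h) <= 5 ^+ k * decay k x.
Proof.
move=> h4; rewrite /decay -ler_pdivrMl ?exprn_gt0 // -invfM -exprMn.
rewrite lef_pV2 ?posrE ?exprn_gt0 ?mulr_gt0 ?onepnorm_gt0 //.
apply: lerXn2r; rewrite ?nnegrE ?mulr_ge0 ?addr_ge0 //.
have : `|x| <= `|x + h| + `|h| by rewrite -{1}(addrK h x) ler_normB.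
have := normr_ge0 (x + h); lra.
Qed.

End Decay.

(** * Integrals on the line and decay of oscillatory integrals *)

Section OneDimensionalIntegrals.
Context {R : realType}.
Let mu := @lebesgue_measure R.
Implicit Types (f g : R -> R) (B : R -> R[i]).

(* Holds without measurability because the integral of a nonnegative function
   is a supremum over the simple functions below it. *)
Lemma ge0_le_integral_nonmeasurable (f g : R -> \bar R) :
  (forall x, 0%E <= f x)%E -> (forall x, f x <= g x)%E ->
  (\int[mu]_x f x <= \int[mu]_x g x)%E.
Proof.
move=> f0 fg; have g0 x : (0 <= g x)%E by apply: le_trans (fg x).
rewrite !ge0_integralE //; apply: le_ereal_sup => _ [h hf <-]; exists h => //.
by move=> x; apply: le_trans (hf x) _; rewrite !patch_setT.
Qed.

(** Evenness reduces the integral to the half-line, where [F] is an antiderivative that tends to 0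
    at infinity because [1 < s]. The exponent is real because the later applications take [s = q] or
    a value between 1 and [q / 2]. *)
Lemma integral_powR_decay_lty (s : R) : 1 < s ->
  (\int[mu]_x ((1 + `|x|) `^ (- s))%:E < +oo)%E.
Proof.
move=> s1.
have c1 : continuous (fun x : R => (1 + `|x|) `^ (- s)).
  move=> x; apply: (@continuous_comp _ _ _ (fun y : R => 1 + `|y|) (@powR R ^~ (- s))).
    by apply: cvgD; [exact: cvg_cst|exact: norm_continuous].
  apply: differentiable_continuous; apply/derivable1_diffP.
  by apply: derivable_powR; rewrite in_itv /= andbT onepnorm_gt0.
have p0 (x : R) : 0 <= (1 + `|x|) `^ (- s) by exact: powR_ge0.
rewrite (ge0_symfun_integralT p0 c1); last by move=> x /=; rewrite normrN.
have -> : [set x : R | 0 <= x] = `[0, +oo[%classic.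
  by apply/seteqP; split => x /=; rewrite in_itv /= andbT.
pose F (x : R) := (1 - s)^-1 * (1 + x) `^ (1 - s).
have s1' : 1 - s != 0 by rewrite lt_eqF // subr_lt0.
have dF (x : R) : 0 <= x -> is_derive x 1 F ((1 + x) `^ (- s)).
  move=> x0; have x1 : 0 < 1 + x by rewrite ltr_pwDl.
  have d1 := @is_derive1_powR R (1 - s) _ x1.
  have d2 : is_derive x 1 (fun y : R => 1 + y) 1.
    rewrite (_ : (fun y : R => 1 + y) = (fun y => y + 1)).
      by apply: is_derive_eq; rewrite addr0.
    by apply/funext => y; rewrite addrC.
  have d3 := is_deriveZ (1 - s)^-1 (is_derive1_comp d1 d2).
  apply: (is_derive_eq d3); rewrite /GRing.scale /= mulr1.
  by rewrite mulrA mulVf // mul1r addrAC subrr add0r.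
rewrite (@ge0_continuous_FTC2y R _ F 0 0).
- by rewrite sub0e -EFinN -EFinM ltry.
- by move=> x x0; exact: powR_ge0.
- exact: continuous_subspaceT.
- rewrite -(mulr0 (1 - s)^-1); apply: cvgMr; apply/cvgr0Pnorm_le => e e0.
  have s1'' : 0 < s - 1 by rewrite subr_gt0.
  near=> x.
  have x0 : 0 < 1 + x by rewrite ltr_pwDl //; near: x; exact: nbhs_pinfty_ge.
  rewrite ger0_norm ?powR_ge0 // -opprB powRN -[leRHS]invrK.
  rewrite lef_pV2 ?posrE ?powR_gt0 ?invr_gt0 //.
  have -> : e^-1 = (e^-1 `^ (s - 1)^-1) `^ (s - 1).
    by rewrite -powRrM mulVf ?gt_eqF // powRr1 // invr_ge0 ltW.
  rewrite ge0_ler_powR ?nnegrE ?powR_ge0 // ?ltW //.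
  rewrite (@le_lt_trans _ _ x) ?ltrDr //; near: x; exact: nbhs_pinfty_ge.
- by move=> x /ltW /dF [].
- have [d0 _] := dF 0 (lexx _).
  apply: cvg_at_right_filter.
  by apply: differentiable_continuous; apply/derivable1_diffP.
- move=> x; rewrite in_itv /= andbT => x0; rewrite derive1E.
  by rewrite (@derive_val _ _ _ _ _ _ _ (dF x (ltW x0))) gtr0_norm.
Unshelve. all: by end_near. Qed.

Definition decay_mass : R := fine (\int[mu]_x (decay 2 x)%:E).

Lemma decayE (x : R) : decay 2 x = (1 + `|x|) `^ (- 2).
Proof. by rewrite powRN powR_mulrn // ltW // onepnorm_gt0. Qed.

Lemma integral_decay_lty : (\int[mu]_x (decay 2 x)%:E < +oo)%E.
Proof.
by under eq_integral do rewrite decayE; apply: integral_powR_decay_lty; rewrite ltr1n.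
Qed.

Lemma integral_decayE : (\int[mu]_x (decay 2 x)%:E)%E = decay_mass%:E.
Proof.
rewrite fineK // ge0_fin_numE ?integral_decay_lty //.
by apply: integral_ge0 => x _; rewrite lee_fin decay_ge0.
Qed.

Lemma decay_mass_ge0 : 0 <= decay_mass.
Proof.
by rewrite -lee_fin -integral_decayE; apply: integral_ge0 => x _; rewrite lee_fin decay_ge0.
Qed.

(** A convenient class of integrands: continuity gives measurability, the weight gives
    integrability, and the class is stable under sums, translations and bounded continuous
    factors. *)
Definition cdecay B := [/\ continuous (fun x => complex.Re (B x)),
  continuous (fun x => complex.Im (B x)) &
  exists C, forall x, cmod (B x) <= C * decay 2 x].

Lemma integrable_decay C : mu.-integrable setT (EFin \o (fun x => C * decay 2 x)).
Proof.
suff h : mu.-integrable setT (EFin \o (decay 2 : R -> R)).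
  by apply: eq_integrable (integrableZl measurableT C h) => // x _.
apply/integrableP; split.
  by apply/measurable_EFinP; apply: continuous_measurable_fun; exact: decay_continuous.
under eq_integral do rewrite /= ger0_norm ?decay_ge0 //.
exact: integral_decay_lty.
Qed.

Lemma continuous_decay_integrable f C : continuous f ->
  (forall x, `|f x| <= C * decay 2 x) -> mu.-integrable setT (EFin \o f).
Proof.
move=> cf fC; apply: le_integrable (integrable_decay C) => //.
  by apply/measurable_EFinP; apply: continuous_measurable_fun.
by move=> x _ /=; rewrite lee_fin (le_trans (fC x)) // ler_norm.
Qed.

Lemma cdecay_integrable_Re B : cdecay B ->
  mu.-integrable setT (EFin \o (fun x => complex.Re (B x))).
Proof.
move=> [cr ci [C BC]]; apply: (@continuous_decay_integrable _ C) => // x.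
exact: le_trans (normr_Re_le _) (BC x).
Qed.

Lemma cdecay_integrable_Im B : cdecay B ->
  mu.-integrable setT (EFin \o (fun x => complex.Im (B x))).
Proof.
move=> [cr ci [C BC]]; apply: (@continuous_decay_integrable _ C) => // x.
exact: le_trans (normr_Im_le _) (BC x).
Qed.

Definition cint1 B : R[i] :=
  Complex (Rintegral mu setT (fun x => complex.Re (B x)))
          (Rintegral mu setT (fun x => complex.Im (B x))).

Lemma cReM (z y : R[i]) :
  complex.Re (z * y) = complex.Re z * complex.Re y - complex.Im z * complex.Im y.
Proof. by case: z; case: y. Qed.

Lemma cImM (z y : R[i]) :
  complex.Im (z * y) = complex.Re z * complex.Im y + complex.Im z * complex.Re y.
Proof. by case: z; case: y. Qed.

Lemma cReD (z y : R[i]) : complex.Re (z + y) = complex.Re z + complex.Re y.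
Proof. by case: z; case: y. Qed.

Lemma cImD (z y : R[i]) : complex.Im (z + y) = complex.Im z + complex.Im y.
Proof. by case: z; case: y. Qed.

Lemma cReN (z : R[i]) : complex.Re (- z) = - complex.Re z.
Proof. by case: z. Qed.

Lemma cImN (z : R[i]) : complex.Im (- z) = - complex.Im z.
Proof. by case: z. Qed.

Definition ccontinuous (u : R -> R[i]) := continuous (fun x => complex.Re (u x)) /\
  continuous (fun x => complex.Im (u x)).

Lemma ccontinuousM u v : ccontinuous u -> ccontinuous v ->
  ccontinuous (fun x => u x * v x).
Proof.
move=> [ur ui] [vr vi]; split=> x.
- under eq_fun do rewrite cReM.
  by apply: cvgB; apply: cvgM; [exact: ur|exact: vr|exact: ui|exact: vi].
- under eq_fun do rewrite cImM.
  by apply: cvgD; apply: cvgM; [exact: ur|exact: vi|exact: ui|exact: vr].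
Qed.

Lemma ccontinuousD u v : ccontinuous u -> ccontinuous v ->
  ccontinuous (fun x => u x + v x).
Proof.
move=> [ur ui] [vr vi]; split=> x.
- by under eq_fun do rewrite cReD; apply: cvgD; [exact: ur|exact: vr].
- by under eq_fun do rewrite cImD; apply: cvgD; [exact: ui|exact: vi].
Qed.

Lemma ccontinuous_cst (z : R[i]) : ccontinuous (fun=> z).
Proof. by split=> x; exact: cvg_cst. Qed.

Lemma ccontinuous_expi (a : R) : ccontinuous (fun x => expi (a * x)).
Proof.
have c : continuous (fun x : R => a * x).
  by move=> x; apply: cvgM; [exact: cvg_cst|exact: cvg_id].
split=> x; apply: (continuous_comp (c x)).
- exact: continuous_cos.
- exact: continuous_sin.
Qed.

Lemma cdecayM (u : R -> R[i]) (b : R) B : ccontinuous u ->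
  (forall x, cmod (u x) <= b) -> cdecay B -> cdecay (fun x => u x * B x).
Proof.
move=> cu ub [r i [C BC]].
have [r' i'] := ccontinuousM cu (conj r i).
split=> //; exists (b * C) => x; rewrite cmodM -mulrA.
by apply: ler_pM; rewrite ?cmod_ge0.
Qed.

Lemma cdecayD B1 B2 : cdecay B1 -> cdecay B2 -> cdecay (fun x => B1 x + B2 x).
Proof.
move=> [r1 i1 [C1 h1]] [r2 i2 [C2 h2]].
have [r' i'] := ccontinuousD (conj r1 i1) (conj r2 i2).
split=> //; exists (C1 + C2) => x.
by rewrite mulrDl (le_trans (cmod_leD _ _)) // lerD.
Qed.

Lemma cdecayZ (a : R[i]) B : cdecay B -> cdecay (fun x => a * B x).
Proof. by apply: (@cdecayM _ (cmod a)) => //; exact: ccontinuous_cst. Qed.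

Lemma cint1D B1 B2 : cdecay B1 -> cdecay B2 ->
  cint1 (fun x => B1 x + B2 x) = cint1 B1 + cint1 B2.
Proof.
move=> h1 h2; rewrite /cint1; apply/eqP; rewrite eq_complex /=.
under eq_Rintegral do rewrite cReD.
under [X in _ && (X == _)]eq_Rintegral do rewrite cImD.
rewrite !RintegralD ?eqxx //.
all: by [exact: cdecay_integrable_Re|exact: cdecay_integrable_Im].
Qed.

Lemma integrableZ_real (f : R -> R) (a : R) : mu.-integrable setT (EFin \o f) ->
  mu.-integrable setT (EFin \o (fun x => a * f x)).
Proof. by move=> h; apply: eq_integrable (integrableZl measurableT a h). Qed.

Lemma cint1Z (a : R[i]) B : cdecay B -> cint1 (fun x => a * B x) = a * cint1 B.
Proof.
move=> h; have hr := cdecay_integrable_Re h; have hi := cdecay_integrable_Im h.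
rewrite /cint1; apply/eqP; rewrite eq_complex cReM cImM /=.
under eq_Rintegral do rewrite cReM.
under [X in _ && (X == _)]eq_Rintegral do rewrite cImM.
rewrite RintegralB ?RintegralD // ?RintegralZl ?eqxx //.
all: exact: integrableZ_real.
Qed.

Lemma normr_Rintegral_le f C : continuous f ->
  (forall x, `|f x| <= C * decay 2 x) -> `|Rintegral mu setT f| <= C * decay_mass.
Proof.
move=> cf fC; have fi := continuous_decay_integrable cf fC.
apply: (le_trans (le_normr_Rintegral _ fi)) => //.
rewrite (_ : C * decay_mass = Rintegral mu setT (fun x => C * decay 2 x)).
  apply: le_Rintegral => //; [exact: (integrable_norm fi)|exact: integrable_decay].
have h := integrable_decay 1.
rewrite RintegralZl //; apply: eq_integrable h => // x _ /=; by rewrite mul1r.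
Qed.

Lemma cmod_cint1_le B C : cdecay B -> (forall x, cmod (B x) <= C * decay 2 x) ->
  cmod (cint1 B) <= C * (2 * decay_mass).
Proof.
move=> [r i _] BC; apply: (le_trans (cmod_le_Re_Im _)).
rewrite mulrCA mulr_natl mulr2n; apply: lerD; apply: normr_Rintegral_le => // x.
- exact: le_trans (normr_Re_le _) (BC x).
- exact: le_trans (normr_Im_le _) (BC x).
Qed.

Lemma integral_shift_ge0 f (h : R) : continuous f -> (forall x, 0 <= f x) ->
  (\int[mu]_x (f (x + h))%:E = \int[mu]_x (f x)%:E)%E.
Proof.
move=> cf f0; have dE (x : R) : is_derive x 1 (fun y : R => y + h) 1.
  by apply: is_derive_eq; rewrite addr0.
have d1 : derive1 (fun y : R => y + h) = cst 1.
  by apply/funext => x; rewrite derive1E (@derive_val _ _ _ _ _ _ _ (dE x)).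
rewrite [RHS](@increasing_ge0_integration_by_substitutionT R (fun y => y + h)) //.
- by apply: eq_integral => x _; rewrite d1 /= /GRing.mul /= mulr1.
- by move=> x y; rewrite ltrD2r.
- by rewrite d1 => x; exact: cvg_cst.
- by rewrite d1; exact: is_cvg_cst.
- by rewrite d1; exact: is_cvg_cst.
- apply/cvgrNyPle => A; near=> x; rewrite -lerBrDr; near: x; apply: nbhs_ninfty_le; exact: num_real.
- apply/cvgryPge => A; near=> x; rewrite -lerBlDr; near: x; apply: nbhs_pinfty_ge; exact: num_real.
Unshelve. all: by end_near. Qed.

Lemma continuous_shift f (h : R) : continuous f -> continuous (fun x => f (x + h)).
Proof.
move=> cf x; apply: (@continuous_comp _ _ _ (fun y : R => y + h) f); last exact: cf.
by apply: cvgD; [exact: cvg_id|exact: cvg_cst].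
Qed.

Lemma decay_translate k (x h : R) : decay k (x + h) <= (decay k h)^-1 * decay k x.
Proof.
rewrite ler_pdivlMl ?decay_gt0 // mulrC.
by have := decay_triangle k (x + h) x; rewrite (addrC x h) addrK.
Qed.

(** The substitution rule above concerns nonnegative integrands. A signed [f] is the difference of
    [f + w] and [w], where [w] is its dominating weight and both are nonnegative. *)
Lemma Rintegral_shift f (h C : R) : continuous f ->
  (forall x, `|f x| <= C * decay 2 x) ->
  Rintegral mu setT (fun x => f (x + h)) = Rintegral mu setT f.
Proof.
move=> cf fC.
have C0 : 0 <= C.
  by have := le_trans (normr_ge0 _) (fC 0); rewrite pmulr_lge0 // decay_gt0.
pose w x := C * decay 2 x; pose g x := f x + w x.
have cw : continuous w.
  by move=> x; apply: cvgM; [exact: cvg_cst|exact: decay_continuous].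
have cg : continuous g by move=> x; apply: cvgD; [exact: cf|exact: cw].
have w0 x : 0 <= w x by rewrite mulr_ge0 // decay_ge0.
have g0 x : 0 <= g x.
  by rewrite -lerBlDr sub0r; have := fC x; rewrite ler_norml => /andP[].
have gC x : `|g x| <= (C + C) * decay 2 x.
  by rewrite mulrDl (le_trans (ler_normD _ _)) // lerD // ger0_norm.
have wC x : `|w x| <= C * decay 2 x by rewrite ger0_norm.
have sh (u : R -> R) D : continuous u -> (forall x, `|u x| <= D * decay 2 x) ->
    mu.-integrable setT (EFin \o (fun x => u (x + h))).
  move=> cu uD; apply: (@continuous_decay_integrable _ (D * (decay 2 h)^-1)).
    exact: continuous_shift.
  move=> x; rewrite -mulrA (le_trans (uD _)) // ler_wpM2l ?decay_translate //.
  by have := le_trans (normr_ge0 _) (uD 0); rewrite pmulr_lge0 // decay_gt0.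
have E (u : R -> R) : continuous u -> (forall x, 0 <= u x) ->
    Rintegral mu setT (fun x => u (x + h)) = Rintegral mu setT u.
  by move=> cu u0; rewrite /Rintegral integral_shift_ge0.
transitivity (Rintegral mu setT (fun x => g (x + h) - w (x + h))).
  by apply: eq_Rintegral => x _; rewrite addrK.
transitivity (Rintegral mu setT (fun x => g x - w x)); last first.
  by apply: eq_Rintegral => x _; rewrite addrK.
rewrite !RintegralB ?E //.
- exact: continuous_decay_integrable cg gC.
- exact: continuous_decay_integrable cw wC.
- exact: sh cg gC.
- exact: sh cw wC.
Qed.

Lemma cint1_shift B (h : R) : cdecay B -> cint1 (fun x => B (x + h)) = cint1 B.
Proof.
move=> [r i [C BC]]; congr Complex.
- apply: (@Rintegral_shift (fun x => complex.Re (B x)) h C) => // x.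
  exact: le_trans (normr_Re_le _) (BC x).
- apply: (@Rintegral_shift (fun x => complex.Im (B x)) h C) => // x.
  exact: le_trans (normr_Im_le _) (BC x).
Qed.

Lemma cdecay_shift B (h : R) : cdecay B -> cdecay (fun x => B (x + h)).
Proof.
move=> [r i [C BC]]; split; [exact: (continuous_shift r)|exact: (continuous_shift i)|].
exists (C * (decay 2 h)^-1) => x.
rewrite -mulrA (le_trans (BC _)) // ler_wpM2l ?decay_translate //.
by have := le_trans (cmod_ge0 _) (BC 0); rewrite pmulr_lge0 // decay_gt0.
Qed.

Lemma lipschitz_at_continuous f (C : R) :
  (forall x h, `|h| <= 4 -> `|f (x + h) - f x| <= C * `|h|) -> continuous f.
Proof.
move=> fC x; apply/cvgrPdist_le => e e0.
have C1 : 0 < `|C| + 1 by rewrite ltr_pwDr.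
near=> y.
have yx : `|y - x| <= Num.min 4 (e / (`|C| + 1)).
  near: y.
  have /cvgrPdist_le : (y @[y --> x] --> x) by exact: cvg_id.
  move=> /(_ (Num.min 4 (e / (`|C| + 1)))) H.
  apply: filterS (H _) => [y|]; first by rewrite distrC.
  by rewrite lt_min ltr0n /= divr_gt0.
move: yx; rewrite le_min => /andP[y4]; rewrite ler_pdivlMr // => ye.
rewrite distrC -{1}(subrKC x y) (le_trans (fC _ _ y4)) // (le_trans _ ye) // mulrC.
by rewrite ler_wpM2l // (le_trans (ler_norm _)) // lerDl.
Unshelve. all: by end_near. Qed.

(** A difference version of being C^1 with decaying derivative. Differences commute with integrals
    by linearity, so a function obtained by integrating out the other coordinates inherits this
    property directly. *)
Definition smooth_decay (C : R) B := (forall x, cmod (B x) <= C * decay 2 x) /\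
  (forall x h, `|h| <= 4 -> cmod (B (x + h) - B x) <= C * `|h| * decay 2 x).

Lemma smooth_decay_ge0 C B : smooth_decay C B -> 0 <= C.
Proof.
by case=> [/(_ 0) h _]; have := le_trans (cmod_ge0 _) h; rewrite pmulr_lge0 // decay_gt0.
Qed.

Lemma smooth_decay_cdecay C B : smooth_decay C B -> cdecay B.
Proof.
move=> BB; have C0 := smooth_decay_ge0 BB; case: BB => B1 B2.
have B3 x h : `|h| <= 4 -> cmod (B (x + h) - B x) <= C * `|h|.
  move=> h4; rewrite (le_trans (B2 x h h4)) // ler_piMr ?decay_le1 //.
  by rewrite mulr_ge0.
split; [| |by exists C].
- apply: (@lipschitz_at_continuous _ C) => x h /(B3 x) /(le_trans _); apply.
  by have := normr_Re_le (B (x + h) - B x); rewrite cReD cReN.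
- apply: (@lipschitz_at_continuous _ C) => x h /(B3 x) /(le_trans _); apply.
  by have := normr_Im_le (B (x + h) - B x); rewrite cImD cImN.
Qed.

(* Translating the integrand by half a period of the character changes the sign
   of the character, so the integral only sees a difference of [B]. *)
Lemma cmod_cint1_expi C B (xi : R) : smooth_decay C B ->
  cmod (cint1 (fun x => expi (- xi * x) * B x)) <= C * (8 * decay_mass) * decay 1 xi.
Proof.
move=> sB; have C0 := smooth_decay_ge0 sB; have dB := smooth_decay_cdecay sB.
have [B1 B2] := sB; have m0 := decay_mass_ge0.
have pi4 : pi <= 4 :> R by have := @pihalf_lt2 R; lra.
pose e x := expi (- xi * x); have ce := ccontinuous_expi (- xi).
have ue x : cmod (e x) <= 1 by rewrite cmod_expi.
have rho : (1 + `|xi|) * decay 1 xi = 1 by rewrite /decay expr1 divff // gt_eqF // onepnorm_gt0.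
have rho0 := decay_ge0 1 xi.
have eB : cdecay (fun x => e x * B x) by exact: cdecayM ce ue dB.
(* For [|xi| < 1] the half period may be arbitrarily long, so the trivial bound is used; it suffices
   because [decay 1 xi] is then at least 1/2. *)
case: (ltrP `|xi| 1) => xi1.
  apply: (@le_trans _ _ (C * (2 * decay_mass))).
    apply: cmod_cint1_le => // x; rewrite cmodM cmod_expi mul1r; exact: B1.
  have r2 : 0 <= 2 * decay 1 xi - 1.
    by rewrite subr_ge0 -[leLHS]rho ler_wpM2r //; lra.
  by rewrite -mulrA ler_wpM2l //; have := mulr_ge0 m0 r2; lra.
have xi0 : xi != 0 by rewrite -normr_gt0 (lt_le_trans _ xi1).
pose h := pi / xi.
have h4 : `|h| <= 4.
  rewrite normrM normfV (ger0_norm (pi_ge0 R)) ler_pdivrMr ?normr_gt0 //.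
  by rewrite (le_trans pi4) // ler_peMr.
have eh x : e (x + h) = - e x.
  rewrite /e (_ : - xi * (x + h) = - xi * x + - pi); last by rewrite /h; field.
  rewrite expiD -(expi_conj pi) expi_pi.
  suff -> : conjc (-1 : R[i]) = -1 by rewrite mulrN1.
  by apply/eqP; rewrite eq_complex /= !oppr0 !eqxx.
pose J := cint1 (fun x => e x * B x).
have J2 : cint1 (fun x => e x * (B (x + h) - B x)) = - J - J.
  transitivity (cint1 (fun x => -1 * (e (x + h) * B (x + h)) + -1 * (e x * B x))).
    by congr cint1; apply/funext => x; rewrite eh; ring.
  have eB' := @cdecay_shift (fun x => e x * B x) h eB.
  rewrite cint1D ?cint1Z ?(cint1_shift h eB) ?mulN1r //; exact: cdecayZ.
have : cmod (- J - J) <= (C * `|h|) * (2 * decay_mass).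
  rewrite -J2; apply: cmod_cint1_le.
    by apply: cdecayM ce ue _; apply: cdecayD (cdecay_shift h dB) _;
       under eq_fun do rewrite -mulN1r; exact: cdecayZ.
  by move=> x; rewrite cmodM cmod_expi mul1r; exact: B2.
have -> : - J - J = Complex (-2) 0 * J.
  by case: (J) => a b; apply/eqP; rewrite eq_complex /=; apply/andP; split; apply/eqP; ring.
rewrite cmodM cmod_real normrN normr_nat => H.
(* Since [1 <= |xi|], one has [1 + |xi| <= 2 |xi|]; together with [pi <= 4] this gives the factor
   8. *)
have h2 : `|h| <= 8 * decay 1 xi.
  rewrite normrM normfV (ger0_norm (pi_ge0 R)) ler_pdivrMr ?normr_gt0 //.
  rewrite (le_trans pi4) //; nra.
have : C * `|h| * (2 * decay_mass) <= C * (8 * decay 1 xi) * (2 * decay_mass).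
  by rewrite ler_wpM2r ?mulr_ge0 // ler_wpM2l.
rewrite -/J; lra.
Qed.

End OneDimensionalIntegrals.

(** * Iterated complex integrals and Fourier transforms coordinate by coordinate *)

Section IteratedIntegrals.
Context {R : realType}.
Implicit Types (F G b : seq R -> R[i]).

Fixpoint iint k F : R[i] := match k with
  | 0 => F [::]
  | k'.+1 => cint1 (fun x => iint k' (fun s => F (x :: s)))
  end.

Lemma iintS k F : iint k.+1 F = cint1 (fun x => iint k (fun s => F (x :: s))).
Proof. by []. Qed.

(** Requiring [cdecay] of every partial integral keeps each stage finite. Hence [fine] in [cint]
    loses nothing, and linearity passes through all the levels. *)
Fixpoint iintegrable k F : Prop := match k with
  | 0 => True
  | k'.+1 => (forall x, iintegrable k' (fun s => F (x :: s))) /\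
      cdecay (fun x => iint k' (fun s => F (x :: s)))
  end.

Lemma iterint_Re_Im k F : iintegrable k F ->
  iterint k (fun s => (complex.Re (F s))%:E) = (complex.Re (iint k F))%:E /\
  iterint k (fun s => (complex.Im (F s))%:E) = (complex.Im (iint k F))%:E.
Proof.
elim: k F => [//|k IH] F /= [hs hd].
have hr := integrable_fin_num measurableT (cdecay_integrable_Re hd).
have hi := integrable_fin_num measurableT (cdecay_integrable_Im hd).
split.
- rewrite /Rintegral fineK //.
  by apply: eq_integral => x _; have [] := IH _ (hs x).
- rewrite /Rintegral fineK //.
  by apply: eq_integral => x _; have [] := IH _ (hs x).
Qed.

Lemma iintD k F G : iintegrable k F -> iintegrable k G ->
  iintegrable k (fun s => F s + G s) /\
  iint k (fun s => F s + G s) = iint k F + iint k G.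
Proof.
elim: k F G => [//|k IH] F G /= [fs fd] [gs gd].
have E x := (IH _ _ (fs x) (gs x)).2.
split; [split|].
- by move=> x; have [] := IH _ _ (fs x) (gs x).
- by under eq_fun do rewrite E; exact: cdecayD.
- by under eq_fun do rewrite E; exact: cint1D.
Qed.

Lemma iintZ k (a : R[i]) F : iintegrable k F ->
  iintegrable k (fun s => a * F s) /\ iint k (fun s => a * F s) = a * iint k F.
Proof.
elim: k F => [//|k IH] F /= [fs fd].
have E x := (IH _ (fs x)).2.
split; [split|].
- by move=> x; have [] := IH _ (fs x).
- by under eq_fun do rewrite E; exact: cdecayZ.
- by under eq_fun do rewrite E; exact: cint1Z.
Qed.

Lemma iintB k F G : iintegrable k F -> iintegrable k G ->
  iint k (fun s => F s - G s) = iint k F - iint k G.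
Proof.
move=> hF hG; have [h1 h2] := iintZ (-1) hG; have [_ E] := iintD hF h1.
by rewrite -[- iint k G]mulN1r -h2 -E; congr iint; apply/funext => s; rewrite mulN1r.
Qed.

(* Every coordinate is either frozen or differenced once.  The oscillation argument uses
   steps [pi / xi] with [1 <= `|xi|], whence the bound 4 on the steps. *)
Fixpoint tame k (w : nat -> R -> R) (C : R) b : Prop := match k with
  | 0 => cmod (b [::]) <= C
  | k'.+1 => (forall x, tame k' (fun i => w i.+1) (C * w 0%N x) (fun s => b (x :: s))) /\
      (forall x h, `|h| <= 4 -> tame k' (fun i => w i.+1) (C * `|h| * w 0%N x)
         (fun s => b (x + h :: s) - b (x :: s)))
  end.

(** The factors [c i] depend on the coordinate and accumulate in the constant as a product. With
    Peetre's inequality this moves decay from the integration variable into the position [x] of the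
    short-time Fourier transform. *)
Lemma tame_weaken k (v w : nat -> R -> R) (c : nat -> R) (C C' : R) b :
  (forall i x, 0 <= v i x) -> (forall i x, v i x <= c i * w i x) ->
  0 <= C -> C * (\prod_(i < k) c i) <= C' -> (forall i x, 0 <= w i x) ->
  (forall i, 0 <= c i) ->
  tame k v C b -> tame k w C' b.
Proof.
elim: k v w c C C' b => [|k IH] v w c C C' b v0 vw C0 CC w0 c0.
  by rewrite big_ord0 mulr1 in CC; move=> /le_trans; apply.
move: CC; rewrite big_ord_recl /= => CC [bs bd].
have P0 : 0 <= \prod_(i < k) c (bump 0 i) by apply: prodr_ge0.
split=> [x|x h h4].
- apply: (IH (fun i => v i.+1) _ (fun i => c i.+1) _ _ _ _ _ _ _ _ _ (bs x)) => //.
  + by rewrite mulr_ge0.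
  + apply: (@le_trans _ _ (C * (c 0%N * \prod_(i < k) c (bump 0 i)) * w 0%N x)).
      have -> : C * (c 0%N * \prod_(i < k) c (bump 0 i)) * w 0%N x =
        C * (c 0%N * w 0%N x) * \prod_(i < k) c (bump 0 i) by ring.
      by apply: ler_pM => //; rewrite ?mulr_ge0 // ler_wpM2l.
    by rewrite ler_wpM2r.
- apply: (IH (fun i => v i.+1) _ (fun i => c i.+1) _ _ _ _ _ _ _ _ _ (bd x h h4)) => //.
  + by rewrite !mulr_ge0.
  + apply: (@le_trans _ _ (C * (c 0%N * \prod_(i < k) c (bump 0 i)) * `|h| * w 0%N x)).
      have -> : C * (c 0%N * \prod_(i < k) c (bump 0 i)) * `|h| * w 0%N x =
        C * `|h| * (c 0%N * w 0%N x) * \prod_(i < k) c (bump 0 i) by ring.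
      by apply: ler_pM => //; rewrite ?mulr_ge0 // ler_wpM2l // mulr_ge0.
    by rewrite ler_wpM2r // ler_wpM2r.
Qed.

Lemma tame_le k (w : nat -> R -> R) (C C' : R) b : (forall i x, 0 <= w i x) ->
  0 <= C -> C <= C' -> tame k w C b -> tame k w C' b.
Proof.
move=> w0 C0 CC; apply: (@tame_weaken _ _ _ (fun=> 1)) => // [i x|].
  by rewrite mul1r.
by rewrite big1 // mulr1.
Qed.

Lemma tameD k (w : nat -> R -> R) (C D : R) b b' :
  tame k w C b -> tame k w D b' -> tame k w (C + D) (fun s => b s + b' s).
Proof.
elim: k w C D b b' => [|k IH] w C D b b' /=.
  by move=> h1 h2; rewrite (le_trans (cmod_leD _ _)) // lerD.
move=> [bs bd] [bs' bd']; split=> [x|x h h4].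
  by rewrite mulrDl; apply: IH.
rewrite -mulrA mulrDl !mulrA.
under [X in tame _ _ _ X]eq_fun do rewrite opprD addrACA.
exact: IH (bd x h h4) (bd' x h h4).
Qed.

Lemma tame_unit k (w : nat -> R -> R) (C : R) (z : R[i]) b : cmod z = 1 ->
  tame k w C b -> tame k w C (fun s => z * b s).
Proof.
move=> z1; elim: k w C b => [|k IH] w C b /=.
  by rewrite cmodM z1 mul1r.
move=> [bs bd]; split=> [x|x h h4]; first exact: IH.
by under [X in tame _ _ _ X]eq_fun do rewrite -mulrBr; apply: IH; exact: bd.
Qed.

(** The Leibniz rule for differences. One of its two terms evaluates the second factor at the
    shifted point, which costs [K]; hence [1 + K] for each coordinate. *)
Lemma tameM k (v w : nat -> R -> R) (C D K : R) b b' : 0 <= C -> 0 <= D -> 0 <= K ->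
  (forall i x, 0 <= v i x) -> (forall i x, 0 <= w i x) ->
  (forall i x h, `|h| <= 4 -> w i (x + h) <= K * w i x) ->
  tame k v C b -> tame k w D b' ->
  tame k (fun i x => v i x * w i x) ((1 + K) ^+ k * (C * D)) (fun s => b s * b' s).
Proof.
move=> + + K0; elim: k v w C D b b' => [|k IH] v w C D b b' C0 D0 v0 w0 wK /=.
  by rewrite expr0 mul1r cmodM => h1 h2; apply: ler_pM; rewrite ?cmod_ge0.
move=> [bs bd] [bs' bd'].
have P0 : 0 <= (1 + K) ^+ k by rewrite exprn_ge0 // addr_ge0.
have vw0 i x : 0 <= v i.+1 x * w i.+1 x by rewrite mulr_ge0.
split=> [x|x h h4].
- apply: tame_le (IH _ _ _ _ _ _ _ _ _ _ _ (bs x) (bs' x)) => //.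
  + by rewrite !mulr_ge0.
  + have -> : (1 + K) ^+ k.+1 * (C * D) * (v 0%N x * w 0%N x) =
     (1 + K) * ((1 + K) ^+ k * (C * v 0%N x * (D * w 0%N x))) by rewrite exprS; ring.
    by rewrite ler_peMl ?mulr_ge0 // lerDl.
  + by rewrite mulr_ge0.
  + by rewrite mulr_ge0.
  + by move=> i y l l4; exact: wK.
- have -> : (fun s => b (x + h :: s) * b' (x + h :: s) - b (x :: s) * b' (x :: s)) =
    (fun s => (b (x + h :: s) - b (x :: s)) * b' (x + h :: s) +
       b (x :: s) * (b' (x + h :: s) - b' (x :: s))).
    by apply/funext => s; ring.
  have t1 := IH _ _ _ _ _ _ _ _ (fun i => v0 i.+1) (fun i => w0 i.+1)
    (fun i => wK i.+1) (bd x h h4) (bs' (x + h)).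
  have t2 := IH _ _ _ _ _ _ _ _ (fun i => v0 i.+1) (fun i => w0 i.+1)
    (fun i => wK i.+1) (bs x) (bd' x h h4).
  apply: tame_le (tameD (t1 _ _) (t2 _ _)) => //; rewrite ?addr_ge0 ?mulr_ge0 //.
  have -> : (1 + K) ^+ k.+1 * (C * D) * `|h| * (v 0%N x * w 0%N x) =
     (1 + K) ^+ k * (C * `|h| * v 0%N x * (D * (K * w 0%N x))) +
     (1 + K) ^+ k * (C * v 0%N x * (D * `|h| * w 0%N x)) by rewrite exprS; ring.
  rewrite lerD2r ler_wpM2l // ler_wpM2l ?mulr_ge0 // ler_wpM2l //.
  exact: wK.
Qed.

Fixpoint character k (xi : nat -> R) (s : seq R) : R[i] := match k with
  | 0 => 1
  | k'.+1 => expi (- xi 0%N * head 0 s) * character k' (fun i => xi i.+1) (behead s)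
  end.

Definition osc_const : R := 8 * decay_mass.

Lemma osc_const_ge0 : 0 <= osc_const.
Proof. by rewrite mulr_ge0 // decay_mass_ge0. Qed.

(** The Fourier transform in all coordinates but the first, which stays free for the multiplier to
    act on. *)
Definition partial_transform k (xi : nat -> R) b (x : R) : R[i] :=
  iint k (fun s => b (x :: s) * character k xi s).

Lemma tame_iint k (xi : nat -> R) (C : R) b : tame k (fun=> decay 2) C b ->
  iintegrable k (fun s => b s * character k xi s) /\
  cmod (iint k (fun s => b s * character k xi s)) <=
    C * osc_const ^+ k * \prod_(i < k) decay 1 (xi i).
Proof.
elim: k xi C b => [|k IH] xi C b.
  by rewrite /= !mulr1 big_ord0 mulr1.
move=> [bs bd]; pose xi' i := xi i.+1.
pose B := partial_transform k xi' b.
have sB : smooth_decay (C * osc_const ^+ k * \prod_(i < k) decay 1 (xi' i)) B.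
  split=> [x|x h h4].
    apply: le_trans (IH xi' _ _ (bs x)).2 _.
    by rewrite le_eqVlt; apply/orP; left; apply/eqP; ring.
  rewrite /B /partial_transform -iintB; [|exact: (IH _ _ _ (bs _)).1..].
  under [X in iint _ X]eq_fun do rewrite -mulrBl.
  apply: le_trans (IH xi' _ _ (bd x h h4)).2 _.
  by rewrite le_eqVlt; apply/orP; left; apply/eqP; ring.
have E x : iint k (fun s => b (x :: s) * character k.+1 xi (x :: s)) =
    expi (- xi 0%N * x) * B x.
  rewrite /= -(iintZ _ (IH xi' _ _ (bs x)).1).2.
  by congr iint; apply/funext => s; rewrite mulrCA.
split; first split.
- move=> x /=.
  have -> : (fun s => b (x :: s) * (expi (- xi 0%N * x) * character k xi' s)) =
      (fun s => expi (- xi 0%N * x) * (b (x :: s) * character k xi' s)).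
    by apply/funext => s; rewrite mulrCA.
  exact: (iintZ _ (IH xi' _ _ (bs x)).1).1.
- under eq_fun do rewrite E.
  apply: (cdecayM (ccontinuous_expi _) (b := 1)); last exact: smooth_decay_cdecay sB.
  by move=> x; rewrite cmod_expi.
- rewrite iintS; under [X in cint1 X]eq_fun do rewrite E.
  apply: le_trans (cmod_cint1_expi _ sB) _.
  rewrite big_ord_recl /= exprSr le_eqVlt; apply/orP; left; apply/eqP.
  by rewrite -/osc_const /xi'; ring.
Qed.

Lemma tame_partial_transform k (xi : nat -> R) (C : R) b :
  tame k.+1 (fun=> decay 2) C b ->
  smooth_decay (C * osc_const ^+ k * \prod_(i < k) decay 1 (xi i))
    (partial_transform k xi b).
Proof.
move=> [bs bd]; split=> [x|x h h4].
  apply: le_trans (tame_iint xi (bs x)).2 _.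
  by rewrite le_eqVlt; apply/orP; left; apply/eqP; ring.
rewrite /partial_transform -iintB; [|exact: (tame_iint _ (bs _)).1..].
under [X in iint _ X]eq_fun do rewrite -mulrBl.
apply: le_trans (tame_iint xi (bd x h h4)).2 _.
by rewrite le_eqVlt; apply/orP; left; apply/eqP; ring.
Qed.

(** The factor [u] sees only the first variable and leaves the inner integrals untouched.
    Boundedness and continuity of [u] keep the outer integrand in [cdecay], but oscillation in the
    first variable is no longer exploited. *)
Lemma tame_iint_mult k (xi : nat -> R) (C c : R) b (u : R -> R[i]) :
  tame k.+1 (fun=> decay 2) C b -> ccontinuous u -> (forall x, cmod (u x) <= c) ->
  let F s := u (head 0 s) * (b s * character k.+1 xi s) in
  iintegrable k.+1 F /\
  iint k.+1 F = cint1 (fun x => u x *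
    (expi (- xi 0%N * x) * partial_transform k (fun i => xi i.+1) b x)).
Proof.
move=> tb cu uc F; pose xi' i := xi i.+1.
have sB := tame_partial_transform xi' tb; have [bs bd] := tb.
pose B := partial_transform k xi' b.
have E x : iint k (fun s => F (x :: s)) = u x * (expi (- xi 0%N * x) * B x).
  rewrite mulrA -(iintZ _ (tame_iint xi' (bs x)).1).2.
  congr iint; apply/funext => s; rewrite /F /= -mulrA; congr (_ * _).
  by rewrite mulrCA.
split; last by rewrite iintS; congr cint1; apply/funext => x; rewrite E.
split=> [x|].
  have -> : (fun s => F (x :: s)) =
      (fun s => (u x * expi (- xi 0%N * x)) * (b (x :: s) * character k xi' s)).
    by apply/funext => s; rewrite /F /= -mulrA; congr (_ * _); rewrite mulrCA.
  exact: (iintZ _ (tame_iint xi' (bs x)).1).1.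
under eq_fun do rewrite E.
apply: (cdecayM cu uc); apply: (cdecayM (ccontinuous_expi _) (b := 1)).
  by move=> x; rewrite cmod_expi.
exact: smooth_decay_cdecay sB.
Qed.

End IteratedIntegrals.

(** * Mixed differences of Schwartz functions *)

Section SchwartzTame.
Context {R : realType} {n : nat}.
Implicit Types (f g : 'rV[R]_n -> R) (t y : 'rV[R]_n) (es : seq 'I_n).

Definition basis_vec (i : 'I_n) : 'rV[R]_n := delta_mx 0 i.

Lemma derivable_line f t (i : 'I_n) (r : R) : derivable f (t + r *: basis_vec i) (basis_vec i) ->
  is_derive r 1 (fun r' : R => f (t + r' *: basis_vec i))
    ('D_(basis_vec i) f (t + r *: basis_vec i)).
Proof.
move=> df.
have E : (fun h : R => h^-1 *: (f (t + (h *: 1 + r) *: basis_vec i) -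
             f (t + r *: basis_vec i))) =
    (fun h : R => h^-1 *: (f (h *: basis_vec i + (t + r *: basis_vec i)) -
             f (t + r *: basis_vec i))).
  apply/funext => h; congr (_ *: (f _ - _)).
  by rewrite [h%:A]mulr1 scalerDl addrCA.
split; first by rewrite /derivable /= E.
by rewrite /derive /= E.
Qed.

Lemma mvt_coord f (i : 'I_n) : (forall t, derivable f t (basis_vec i)) -> forall t (h : R),
  exists2 th : R, `|th| <= `|h| &
    f (t + h *: basis_vec i) - f t = h * 'D_(basis_vec i) f (t + th *: basis_vec i).
Proof.
move=> df t h.
pose phi (r : R) := f (t + r *: basis_vec i).
have dphi (r : R) : is_derive r 1 phi ('D_(basis_vec i) f (t + r *: basis_vec i)).
  by apply: derivable_line; exact: df.
have cphi : continuous phi.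
  move=> r; have [d _] := dphi r.
  by apply: differentiable_continuous; apply/derivable1_diffP.
have -> : f t = phi 0 by rewrite /phi scale0r addr0.
rewrite -/(phi h).
have [h0|h0|->] := ltgtP h 0; last first.
- by exists 0; rewrite ?mul0r ?subrr.
- have [|c /andP[c1 c2] E] := @MVT_segment R phi _ 0 h (ltW h0) (fun r _ => dphi r).
    exact: continuous_subspaceT.
  exists c; last by rewrite E subr0 mulrC.
  by move: c1 c2; rewrite !bnd_simp => c1 c2; rewrite !ger0_norm // ltW.
- have [|c /andP[c1 c2] E] := @MVT_segment R phi _ h 0 (ltW h0) (fun r _ => dphi r).
    exact: continuous_subspaceT.
  exists c; last by rewrite -opprB E sub0r mulrN opprK mulrC.
  by move: c1 c2; rewrite !bnd_simp => c1 c2; rewrite !ler0_norm ?lerN2 // ltW.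
Qed.

Definition smooth f := forall es i t, derivable (pder es f) t (delta_mx 0 i).

Lemma derivable_translate f t a v :
  derivable (fun x => f (x + a)) t v <-> derivable f (t + a) v.
Proof.
have E : (fun h : R => h^-1 *: (f (h *: v + t + a) - f (t + a))) =
         (fun h : R => h^-1 *: (f (h *: v + (t + a)) - f (t + a))).
  by apply/funext => h; rewrite addrA.
by rewrite /derivable /= E.
Qed.

Lemma derive_translate f t a v :
  'D_v (fun x => f (x + a)) t = 'D_v f (t + a).
Proof.
have E : (fun h : R => h^-1 *: (f (h *: v + t + a) - f (t + a))) =
         (fun h : R => h^-1 *: (f (h *: v + (t + a)) - f (t + a))).
  by apply/funext => h; rewrite addrA.
by rewrite /derive /= E.
Qed.

Lemma pder_translate f a es : pder es (fun x => f (x + a)) = (fun x => pder es f (x + a)).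
Proof.
elim: es => [//|i es IH] /=; apply/funext => t; rewrite IH.
by rewrite derive_translate.
Qed.

Lemma smooth_translate f a : smooth f -> smooth (fun x => f (x + a)).
Proof.
by move=> sf es i t; rewrite pder_translate; apply/derivable_translate; exact: sf.
Qed.

Lemma pderB f g es : smooth f -> smooth g ->
  pder es (fun x => f x - g x) = (fun x => pder es f x - pder es g x).
Proof.
move=> sf sg; elim: es => [//|i es IH] /=; apply/funext => t; rewrite IH.
by rewrite deriveB; [|exact: sf|exact: sg].
Qed.

Lemma smoothB f g : smooth f -> smooth g -> smooth (fun x => f x - g x).
Proof.
by move=> sf sg es i t; rewrite pderB //; apply: derivableB; [exact: sf|exact: sg].
Qed.

Definition pder_bound (w : nat -> R -> R) (m : nat) (A : R) f :=
  forall es, (size es <= m)%N ->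
    forall t, `|pder es f t| <= A * \prod_(i < n) w i (t 0 i).

Lemma prod_weight_shift (w : nat -> R -> R) (K : R) : (forall i x, 0 <= w i x) ->
  (forall i x h, `|h| <= 4 -> w i (x + h) <= K * w i x) ->
  forall t i (h : R), `|h| <= 4 ->
  \prod_(j < n) w j ((t + h *: basis_vec i) 0 j) <= K * \prod_(j < n) w j (t 0 j).
Proof.
move=> w0 wK t i h h4; rewrite (bigD1 i) //= [X in _ <= _ * X](bigD1 i) //= mulrA.
apply: ler_pM => //; first by apply: prodr_ge0.
  by rewrite !mxE !eqxx /= mulr1; exact: wK.
apply: ler_prod => j ji; rewrite w0 !mxE /=.
by rewrite (negbTE ji) mulr0 addr0.
Qed.

(** By the mean value theorem one difference is paid for by one derivative, and [K] accounts for the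
    displaced intermediate point. *)
Lemma pder_bound_diff (w : nat -> R -> R) (K A : R) m f (i : 'I_n) (h : R) :
  (forall i x, 0 <= w i x) -> 0 <= A ->
  (forall i x h, `|h| <= 4 -> w i (x + h) <= K * w i x) ->
  smooth f -> pder_bound w m.+1 A f -> `|h| <= 4 ->
  pder_bound w m (`|h| * K * A) (fun t => f (t + h *: basis_vec i) - f t).
Proof.
move=> w0 A0 wK sf bf h4 es es_m t.
rewrite pderB ?pder_translate //; last exact: smooth_translate.
have [th th1 ->] := mvt_coord (fun t => sf es i t) t h.
rewrite normrM -!mulrA ler_wpM2l // mulrCA.
apply: le_trans (bf (i :: es) es_m _) _; rewrite ler_wpM2l //.
exact: prod_weight_shift (le_trans th1 h4).
Qed.

Lemma rowOfSeq_step (pre s : seq R) (x h : R) (lt : (size pre < n)%N) :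
  rowOfSeq n (pre ++ x + h :: s) =
  rowOfSeq n (pre ++ x :: s) + h *: basis_vec (Ordinal lt).
Proof.
apply/rowP => j; rewrite !mxE !nth_cat /=.
have [jl|jl|je] := ltngtP j (size pre).
- by rewrite -val_eqE /= ltn_eqF // mulr0 addr0.
- rewrite -val_eqE /= gtn_eqF // mulr0 addr0.
  by move: jl; rewrite -subn_gt0; case: (j - size pre)%N.
- by rewrite -val_eqE /= je eqxx subnn mulr1.
Qed.

(** The prefix [pre] holds the coordinates already processed, frozen or differenced; [f] changes
    during the induction because a differenced coordinate replaces it by an increment. At most one
    derivative is spent on each remaining coordinate. *)
Lemma pder_bound_tame (w : nat -> R -> R) (K : R) : 1 <= K -> (forall i x, 0 <= w i x) ->
  (forall i x h, `|h| <= 4 -> w i (x + h) <= K * w i x) ->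
  forall k (pre : seq R) f (A : R), (size pre + k)%N = n -> 0 <= A -> smooth f ->
  pder_bound w k A f ->
  tame k (fun i => w (size pre + i)%N)
    (K ^+ k * A * \prod_(i < size pre) w i (nth 0 pre i))
    (fun s => Complex (f (rowOfSeq n (pre ++ s))) 0).
Proof.
move=> K1 w0 wK; have K0 : 0 <= K by apply: le_trans K1.
elim=> [|k IH] pre f A sz A0 sf bf.
  rewrite addn0 in sz; rewrite /= cats0 cmod_real expr0 mul1r.
  have := bf [::] isT (rowOfSeq n pre); rewrite /=.
  rewrite (eq_bigr (fun i : 'I_n => w i (nth 0 pre i))); last by move=> i _; rewrite mxE.
  by rewrite sz.
have szx x : (size (rcons pre x) + k)%N = n by rewrite size_rcons addSnnS.
have pE x : \prod_(i < size (rcons pre x)) w i (nth 0 (rcons pre x) i) =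
    (\prod_(i < size pre) w i (nth 0 pre i)) * w (size pre) x.
  rewrite size_rcons big_ord_recr /= nth_rcons ltnn eqxx; congr (_ * _).
  by apply: eq_bigr => i _; rewrite nth_rcons ltn_ord.
have wE x : (fun i => w (size pre + i.+1)%N) = (fun i => w (size (rcons pre x) + i)%N).
  by apply/funext => i; rewrite size_rcons addSnnS.
have P0 : 0 <= \prod_(i < size pre) w i (nth 0 pre i) by apply: prodr_ge0.
have lt : (size pre < n)%N by rewrite -sz addnS ltnS leq_addr.
split=> [x|x h h4]; rewrite (wE x) addn0.
- under [X in tame _ _ _ X]eq_fun do rewrite -cat_rcons.
  apply: tame_le (IH (rcons pre x) f A (szx x) A0 sf _) => //.
  + by rewrite !mulr_ge0 ?exprn_ge0 // prodr_ge0.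
  + rewrite pE mulrA ler_wpM2r // ler_wpM2r // ler_wpM2r // exprS.
    by rewrite ler_peMl // exprn_ge0.
  + by move=> es es_k; apply: bf; exact: leqW.
- pose g t := f (t + h *: basis_vec (Ordinal lt)) - f t.
  have -> : (fun s => Complex (f (rowOfSeq n (pre ++ x + h :: s))) 0 -
       Complex (f (rowOfSeq n (pre ++ x :: s))) 0) =
      (fun s => Complex (g (rowOfSeq n (rcons pre x ++ s))) 0).
    apply/funext => s; rewrite rowOfSeq_step cat_rcons /g.
    by apply/eqP; rewrite eq_complex /= subrr !eqxx.
  have := IH (rcons pre x) g (`|h| * K * A) (szx x) _ _
    (pder_bound_diff (Ordinal lt) w0 A0 wK sf bf h4).
  rewrite pE; set C1 := (X in tame _ _ X); set C2 := (X in _ -> tame _ _ X _).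
  suff -> : C1 = C2 by apply; [rewrite !mulr_ge0|apply: smoothB => //; exact: smooth_translate].
  by rewrite /C1 /C2 exprS; ring.
Qed.

Lemma le_coord_enorm t (i : 'I_n) : `|t 0 i| <= enorm t.
Proof.
rewrite /enorm -sqrtr_sqr ler_wsqrtr // (bigD1 i) //= lerDl.
by apply: sumr_ge0 => j _; exact: sqr_ge0.
Qed.

(** Since [1 + |t_i| <= 1 + enorm t], the exponent [N * n] yields the power [N] in each of the [n]
    coordinates. There are finitely many derivatives of order at most [n], so summing their
    constants gives a common one. *)
Lemma schwartz_real_bound f (N : nat) : schwartz_real f ->
  exists2 A : R, 0 <= A & pder_bound (fun=> decay N) n A f.
Proof.
move=> [_ bf].
have [C HC] := boolp.choice (fun es => bf es (N * n)%N).
exists (\sum_(es : n.-bseq 'I_n) `|C es|); first exact: sumr_ge0.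
move=> es es_n t.
have e1 : 0 < 1 + enorm t by rewrite ltr_pwDl // sqrtr_ge0.
apply: (@le_trans _ _ (`|C es| * \prod_(i < n) decay N (t 0 i))); last first.
  rewrite ler_wpM2r //; first by apply: prodr_ge0 => i _; exact: decay_ge0.
  by rewrite (bigD1 (Bseq es_n)) //= lerDl; apply: sumr_ge0.
apply: (@le_trans _ _ (`|C es| * ((1 + enorm t) ^+ (N * n))^-1)).
  by rewrite ler_pdivlMr ?exprn_gt0 // mulrC (le_trans (HC es t)) // ler_norm.
rewrite ler_wpM2l // exprM -[n in _ ^+ n]card_ord -prodr_const -prodfV.
apply: ler_prod => i _; rewrite invr_ge0 exprn_ge0 ?(ltW e1) //=.
rewrite lef_pV2 ?posrE ?exprn_gt0 ?onepnorm_gt0 //.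
apply: lerXn2r; rewrite ?nnegrE ?addr_ge0 ?sqrtr_ge0 //.
by rewrite lerD2l le_coord_enorm.
Qed.

(** Extension by 0 to all natural indices, since the weights in [tame] are indexed by natural
    numbers and shifted during the recursion. *)
Definition coord y (i : nat) : R := if insub i is Some j then y 0 j else 0.

Lemma coordE y (i : 'I_n) : coord y i = y 0 i.
Proof. by rewrite /coord valK. Qed.

Lemma schwartz_real_tame f (N : nat) : schwartz_real f ->
  exists2 C : R, 0 <= C & forall y,
    tame n (fun i x => decay N (x - coord y i)) C
      (fun s => Complex (f (rowOfSeq n s - y)) 0).
Proof.
move=> sf; have [A A0 bA] := schwartz_real_bound N sf.
exists ((5 ^+ N) ^+ n * A) => [|y]; first by rewrite mulr_ge0 // !exprn_ge0.
have := @pder_bound_tame (fun i x => decay N (x - coord y i)) (5 ^+ N) _ _ _ n [::]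
  (fun t => f (t - y)) A.
rewrite /= big_ord0 mulr1; apply => //.
- by rewrite exprn_ege1 // ler1n.
- by move=> i x; exact: decay_ge0.
- by move=> i x h h4; rewrite addrAC; exact: decay_shift.
- by apply: smooth_translate; case: sf.
- move=> es es_n t; rewrite pder_translate; apply: le_trans (bA es es_n _) _.
  rewrite ler_wpM2l // le_eqVlt; apply/orP; left; apply/eqP.
  by apply: eq_bigr => i _; rewrite coordE !mxE.
Qed.

Lemma schwartz_tame (f : 'rV[R]_n -> R[i]) (N : nat) : schwartz f ->
  exists2 C : R, 0 <= C & forall y,
    tame n (fun i x => decay N (x - coord y i)) C (fun s => f (rowOfSeq n s - y)) /\
    tame n (fun i x => decay N (x - coord y i)) C (fun s => conjc (f (rowOfSeq n s - y))).
Proof.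
move=> [sr si]; have [C1 C10 t1] := schwartz_real_tame N sr.
have [C2 C20 t2] := schwartz_real_tame N si.
exists (C1 + C2) => [|y]; first exact: addr_ge0.
have z1 : cmod (Complex 0 1 : R[i]) = 1 by rewrite /cmod /= expr0n expr1n add0r sqrtr1.
have z2 : cmod (Complex 0 (-1) : R[i]) = 1.
  by rewrite /cmod /= expr0n sqrrN expr1n add0r sqrtr1.
split.
- have := tameD (t1 y) (tame_unit z1 (t2 y)); congr (tame _ _ _ _).
  apply/funext => s; case: (f _) => a b.
  by apply/eqP; rewrite eq_complex /= !(mul0r, mulr0, mul1r, subr0, addr0, add0r) !eqxx.
- have := tameD (t1 y) (tame_unit z2 (t2 y)); congr (tame _ _ _ _).
  apply/funext => s; case: (f _) => a b.
  by apply/eqP; rewrite eq_complex /= !(mul0r, mulr0, mulN1r, subr0, addr0, add0r) !eqxx.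
Qed.

Definition windowed (gamma : 'rV[R]_n -> R[i]) y (s : seq R) : R[i] :=
  gamma (rowOfSeq n s) * conjc (gamma (rowOfSeq n s - y)).

(** Of the four powers of decay of [gamma], two combine with the two of its translate to give decay
    in [y] by Peetre's inequality; the other two remain for integrability. *)
Lemma windowed_tame gamma : schwartz gamma ->
  exists2 C : R, 0 <= C & forall y,
    tame n (fun=> decay 2) (C * \prod_(i < n) decay 2 (y 0 i)) (windowed gamma y).
Proof.
move=> sg; have [C1 C10 t1] := schwartz_tame 4 sg.
have [C2 C20 t2] := schwartz_tame 2 sg.
exists ((1 + 5 ^+ 2) ^+ n * (C1 * C2)) => [|y].
  by rewrite !mulr_ge0 // exprn_ge0 // addr_ge0 // exprn_ge0.
have [T1 _] := t1 0; have [_ T2] := t2 y.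
rewrite (eq_bigr (fun i : 'I_n => decay 2 (coord y i))); last by move=> i _; rewrite coordE.
have K0 : 0 <= 5 ^+ 2 :> R by rewrite exprn_ge0.
have wK i (x h : R) : `|h| <= 4 ->
    decay 2 (x + h - coord y i) <= 5 ^+ 2 * decay 2 (x - coord y i).
  by move=> h4; rewrite addrAC; exact: decay_shift.
have T3 := tameM C10 C20 K0 (fun i x => decay_ge0 _ _) (fun i x => decay_ge0 _ _) wK T1 T2.
have {}T3 : tame n (fun i x => decay 4 (x - coord 0 i) * decay 2 (x - coord y i))
    ((1 + 5 ^+ 2) ^+ n * (C1 * C2)) (windowed gamma y).
  by congr (tame _ _ _ _): T3; apply/funext => s; rewrite subr0.
apply: (@tame_weaken _ _ _ _ (fun i => decay 2 (coord y i)) _ _ _ _ _ _ _ _ _ T3) => //.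
- by move=> i x; rewrite mulr_ge0 // decay_ge0.
- move=> i x; rewrite /coord.
  have -> : (if insub i is Some j then (0 : 'rV[R]_n) 0 j else 0) = 0.
    by case: insub => [j|]; rewrite ?mxE.
  rewrite subr0 (decayD 2 2) -mulrA mulrC ler_wpM2r ?decay_ge0 //.
  exact: decay_triangle.
- by rewrite !mulr_ge0 // exprn_ge0 // addr_ge0.
- by move=> i x; exact: decay_ge0.
- by move=> i; exact: decay_ge0.
Qed.

End SchwartzTame.

(** * Iterated integrals of nonnegative functions *)

Section NonnegativeIteratedIntegrals.
Context {R : realType}.
Let mu := @lebesgue_measure R.

Lemma iterint_ge0 k (F : seq R -> \bar R) : (forall s, 0 <= F s)%E ->
  (0 <= iterint k F)%E.
Proof.
elim: k F => [|k IH] F F0 /=; first exact: F0.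
by apply: integral_ge0 => x _; apply: IH => s; exact: F0.
Qed.

Lemma iterint_le k (F G : seq R -> \bar R) : (forall s, 0 <= F s)%E ->
  (forall s, size s = k -> F s <= G s)%E -> (iterint k F <= iterint k G)%E.
Proof.
elim: k F G => [|k IH] F G F0 FG /=; first exact: FG.
apply: ge0_le_integral_nonmeasurable => x; first exact: iterint_ge0.
by apply: IH => // s sk; apply: FG; rewrite /= sk.
Qed.

(** The constant [c] absorbs the factors of the coordinates already fixed, so the induction
    hypothesis applies under the outer integral. *)
Lemma iterint_prod k (g : nat -> R -> R) (I : nat -> R) (c : R) :
  (forall i, measurable_fun [set: measurableTypeR R] (g i)) -> (forall i x, 0 <= g i x) ->
  (forall i, (\int[mu]_x (g i x)%:E)%E = (I i)%:E) -> 0 <= c ->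
  iterint k (fun s => (c * \prod_(i < k) g i (nth 0 s i))%:E) =
  (c * \prod_(i < k) I i)%:E.
Proof.
elim: k g I c => [|k IH] g I c mg g0 gI c0 /=; first by rewrite !big_ord0.
have I0 i : 0 <= I i by rewrite -lee_fin -gI; apply: integral_ge0 => x _; rewrite lee_fin.
transitivity (\int[mu]_x ((c * \prod_(i < k) I i.+1)%:E * (g 0%N x)%:E))%E.
  apply: eq_integral => x _.
  have cg : 0 <= c * g 0%N x by rewrite mulr_ge0.
  have := IH (fun i => g i.+1) (fun i => I i.+1) (c * g 0%N x) (fun i => mg i.+1)
    (fun i => g0 i.+1) (fun i => gI i.+1) cg.
  rewrite -EFinM mulrAC => <-; congr iterint; apply/funext => s.
  by rewrite big_ord_recl /= mulrA.
rewrite ge0_integralZl_EFin //.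
- by rewrite gI -EFinM big_ord_recl /=; congr EFin; rewrite /bump /=; ring.
- by move=> x _; rewrite lee_fin.
- exact/measurable_EFinP.
- by rewrite mulr_ge0 // prodr_ge0.
Qed.

Lemma integral_indic_itv (a b : R) : a <= b ->
  (\int[mu]_y (\1_(`[a, b]%classic : set R) y)%:E = (b - a)%:E)%E.
Proof.
move=> ab; rewrite integral_indic // setIT.
rewrite [LHS]lebesgue_measure_itv /= lte_fin.
by case: (ltgtP a b) ab => // -> _; rewrite subrr.
Qed.

(** [F] dominates [c] times the indicator of the box, and that indicator is a product of
    one-dimensional ones. *)
Lemma iterint_box_ge k (F : seq R -> \bar R) (a b : nat -> R) (c : R) :
  (forall i, a i <= b i) -> 0 <= c -> (forall s, 0 <= F s)%E ->
  (forall s, size s = k -> (forall i, (i < k)%N -> a i <= nth 0 s i <= b i) ->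
     (c%:E <= F s)%E) ->
  ((c * \prod_(i < k) (b i - a i))%:E <= iterint k F)%E.
Proof.
move=> ab c0 F0 cF; pose g i : R -> R := \1_(`[a i, b i]%classic : set R).
rewrite -(@iterint_prod k g (fun i => b i - a i)) // => [|i|i].
- apply: iterint_le => [s|s sk].
    by rewrite lee_fin mulr_ge0 // prodr_ge0.
  have [/forallP H|/forallPn [i Hi]] :=
    boolP [forall i : 'I_k, a i <= nth 0 s i <= b i].
    rewrite big1 ?mulr1; last first.
      by move=> i _; rewrite /g indicE mem_set //= in_itv /=; exact: H.
    by apply: cF => // i ik; exact: (H (Ordinal ik)).
  rewrite (bigD1 i) //= /g indicE memNset ?mul0r ?mulr0 //=.
  by rewrite in_itv /=; apply/negP.
- exact: measurable_indic.
- exact: integral_indic_itv.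
Qed.

Lemma cmod_iint_le k (F : seq R -> R[i]) (C : R) : 0 <= C -> iintegrable k F ->
  (forall s, size s = k -> cmod (F s) <= C * \prod_(i < k) decay 2 (nth 0 s i)) ->
  cmod (iint k F) <= C * (2 * decay_mass) ^+ k.
Proof.
elim: k F C => [|k IH] F C C0.
  by move=> _ /(_ [::] erefl); rewrite big_ord0 expr0.
move=> [Fs Fd] FC; rewrite exprSr mulrA; apply: cmod_cint1_le Fd _ => x.
rewrite mulrAC; apply: IH (Fs x) _ => [|s sk].
  by rewrite mulr_ge0 // decay_ge0.
by have := FC (x :: s); rewrite /= sk big_ord_recl /= mulrA; exact.
Qed.

End NonnegativeIteratedIntegrals.

(** * Lipschitz bounds and continuity of Schwartz functions *)

Section SchwartzLipschitz.
Context {R : realType} {n : nat}.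

(** The segment from [t] to [t + y] is replaced by a path that changes one coordinate at a time; the
    induction runs over the list of coordinates still to be changed. *)
Lemma lipschitz_coord (f : 'rV[R]_n -> R) (L : R) : smooth f ->
  (forall i t, `|pder [:: i] f t| <= L) ->
  forall t y, `|f (t + y) - f t| <= L * \sum_(i < n) `|y 0 i|.
Proof.
move=> sf fL t y; rewrite {1}(row_sum_delta y).
elim: (index_enum _) t => [|i l IH] t.
  by rewrite !big_nil mulr0 addr0 subrr normr0.
rewrite !big_cons addrA mulrDr.
have [th _ E] := mvt_coord (fun t => sf [::] i t) t (y 0 i).
have -> : f (t + y 0 i *: delta_mx 0 i + \sum_(j <- l) y 0 j *: delta_mx 0 j) - f t =
  (f (t + y 0 i *: delta_mx 0 i + \sum_(j <- l) y 0 j *: delta_mx 0 j) -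
   f (t + y 0 i *: delta_mx 0 i)) + (f (t + y 0 i *: delta_mx 0 i) - f t).
  by rewrite addrA subrK.
rewrite addrC (le_trans (ler_normD _ _)) // lerD //.
by rewrite E normrM mulrC ler_wpM2r //; exact: fL.
Qed.

Lemma schwartz_real_lipschitz (f : 'rV[R]_n -> R) : schwartz_real f ->
  exists2 L : R, 0 <= L & forall t y, `|f (t + y) - f t| <= L * \sum_(i < n) `|y 0 i|.
Proof.
move=> sf; have [A A0 bA] := schwartz_real_bound 0 sf; exists A => //.
apply: lipschitz_coord => [|i t]; first by case: sf.
(* The bound covers derivatives of order at most [n]; the presence of an index [i] guarantees that
   order 1 is among them. *)
have n0 : (0 < n)%N by case: (n) i => [[]|].
apply: le_trans (bA [:: i] n0 t) _.
by rewrite big1 ?mulr1 // => j _; rewrite /decay expr0 invr1.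
Qed.

Lemma schwartz_lipschitz (f : 'rV[R]_n -> R[i]) : schwartz f ->
  exists2 L : R, 0 <= L &
    forall t y, cmod (f (t + y) - f t) <= L * \sum_(i < n) `|y 0 i|.
Proof.
move=> [sr si]; have [L1 L10 h1] := schwartz_real_lipschitz sr.
have [L2 L20 h2] := schwartz_real_lipschitz si.
exists (L1 + L2) => [|t y]; first exact: addr_ge0.
rewrite (le_trans (cmod_le_Re_Im _)) // mulrDl lerD // ?cReD ?cReN ?cImD ?cImN //.
Qed.

Lemma schwartz_decay (f : 'rV[R]_n -> R[i]) (N : nat) : schwartz f ->
  exists2 C : R, 0 <= C & forall t, cmod (f t) <= C * \prod_(i < n) decay N (t 0 i).
Proof.
move=> [sr si]; have [A A0 bA] := schwartz_real_bound N sr.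
have [B B0 bB] := schwartz_real_bound N si.
exists (A + B) => [|t]; first exact: addr_ge0.
rewrite (le_trans (cmod_le_Re_Im _)) // mulrDl lerD //.
- exact: (bA [::] isT t).
- exact: (bB [::] isT t).
Qed.

Lemma coord_lipschitz_continuous (f : 'rV[R]_n -> R) (L : R) : 0 <= L ->
  (forall t y, `|f (t + y) - f t| <= L * \sum_(i < n) `|y 0 i|) -> continuous f.
Proof.
move=> L0 fL x; apply/(@cvgrPdist_le _ _ _ (nbhs x) (nbhs_filter x)) => e e0.
have L1 : 0 < L * n%:R + 1 by rewrite ltr_pwDr // mulr_ge0.
have d0 : 0 < e / (L * n%:R + 1) by rewrite divr_gt0.
exists (fun i j => [set z | `|z - x i j| <= e / (L * n%:R + 1)]) => /=.
  move=> i j; have /cvgrPdist_le/(_ _ d0) H : (z @[z --> x i j] --> x i j) by exact: cvg_id.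
  by apply: filterS H => z /=; rewrite distrC.
move=> y /= yx; rewrite distrC -{1}(subrKC x y) (le_trans (fL _ _)) //.
apply: (@le_trans _ _ (L * \sum_(i < n) (e / (L * n%:R + 1)))).
  by rewrite ler_wpM2l // ler_sum // => i _; rewrite !mxE; exact: yx.
rewrite sumr_const card_ord -(mulr_natr (e / _)).
have -> : L * ((e / (L * n%:R + 1)) * n%:R) = e * ((L * n%:R) / (L * n%:R + 1)) by ring.
by rewrite ler_piMr ?(ltW e0) // ler_pdivrMr // mul1r lerDl.
Qed.

Lemma schwartz_continuous (f : 'rV[R]_n -> R[i]) : schwartz f ->
  continuous (fun t => complex.Re (f t)) /\ continuous (fun t => complex.Im (f t)).
Proof.
move=> [sr si]; have [L1 L10 h1] := schwartz_real_lipschitz sr.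
have [L2 L20 h2] := schwartz_real_lipschitz si.
by split; [exact: coord_lipschitz_continuous h1|exact: coord_lipschitz_continuous h2].
Qed.

End SchwartzLipschitz.

(** * Lipschitz bound for the character *)

Section ExpiLipschitz.
Context {R : realType}.

Lemma bounded_derive_lipschitz (f f' : R -> R) : (forall x : R, is_derive x 1 f (f' x)) ->
  (forall x, `|f' x| <= 1) -> forall x y, `|f x - f y| <= `|x - y|.
Proof.
move=> df f1 x y.
have cf : continuous f.
  by move=> r; have [d _] := df r; apply: differentiable_continuous; apply/derivable1_diffP.
wlog xy : x y / y <= x.
  move=> H; case: (leP y x) => [/H //|/ltW /H].
  by rewrite distrC [X in _ <= X]distrC.
have [|c _ ->] := @MVT_segment R f f' y x xy (fun r _ => df r).
  exact: continuous_subspaceT.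
by rewrite normrM ler_piMl.
Qed.

Lemma cmod_expi_sub1 (t : R) : cmod (expi t - 1) <= 2 * `|t|.
Proof.
rewrite (le_trans (cmod_le_Re_Im _)) // mulr_natl mulr2n /= subr0.
have c1 (x : R) : `|cos x| <= 1 by rewrite ler_norml cos_geN1 cos_le1.
have s1 (x : R) : `|sin x| <= 1 by rewrite ler_norml sin_geN1 sin_le1.
apply: lerD.
- rewrite -(@cos0 R) -[X in _ <= `|X|]subr0.
  apply: (@bounded_derive_lipschitz cos (fun x => - sin x)) => x.
  by rewrite normrN.
- rewrite -[X in `|X| <= _]subr0 -(@sin0 R) -[X in _ <= `|X|]subr0.
  exact: (@bounded_derive_lipschitz sin cos).
Qed.

End ExpiLipschitz.

(** * Short-time Fourier transform of multiples of the window *)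

Section ShortTimeFourier.
Context {R : realType} {m : nat}.
Local Notation rV := 'rV[R]_m.+1.
Implicit Types (gamma f : rV -> R[i]) (u v : R -> R[i]) (x xi : rV).

Definition mult u f : rV -> R[i] := fun t => u (t 0 0) * f t.

Lemma character_expi k (xi : nat -> R) (s : seq R) :
  character k xi s = expi (- \sum_(i < k) xi i * nth 0 s i).
Proof.
elim: k xi s => [|k IH] xi s; first by rewrite /= big_ord0 oppr0 expi0.
rewrite /= IH big_ord_recl opprD expiD -mulNr nth0; congr (_ * expi (- _)).
by apply: eq_bigr => i _; rewrite nth_behead.
Qed.

Lemma character0 k (xi : nat -> R) (s : seq R) : (forall i : 'I_k, xi i = 0) ->
  character k xi s = 1.
Proof.
by move=> xi0; rewrite character_expi big1 ?oppr0 ?expi0 // => i _; rewrite xi0 mul0r.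
Qed.

Lemma prod_decay_le1 (I : Type) (r : seq I) k (F : I -> R) :
  \prod_(i <- r) decay k (F i) <= 1.
Proof.
elim: r => [|i r IH]; first by rewrite big_nil.
rewrite big_cons -[leRHS]mulr1 ler_pM ?decay_ge0 ?decay_le1 //.
by apply: prodr_ge0 => j _; exact: decay_ge0.
Qed.

Definition stft_slice gamma x xi : R -> R[i] :=
  partial_transform m (fun i => coord xi i.+1) (windowed gamma x).

Definition stft_mult gamma u x xi : R[i] :=
  cint1 (fun r => u r * (expi (- coord xi 0 * r) * stft_slice gamma x xi r)).

Lemma cint_iint (h : rV -> R[i]) : iintegrable m.+1 (fun s => h (rowOfSeq m.+1 s)) ->
  cint h = iint m.+1 (fun s => h (rowOfSeq m.+1 s)).
Proof.
by move=> /iterint_Re_Im [hr hi]; rewrite /cint /intRn hr hi; case: (iint _ _).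
Qed.

Lemma stft_integrand gamma u x xi :
  (fun s => (fun t => mult u gamma t * conjc (expi (dotRn xi t) * gamma (t - x)))
    (rowOfSeq m.+1 s)) =
  (fun s => u (head 0 s) * (windowed gamma x s * character m.+1 (coord xi) s)).
Proof.
have cM (a b : R[i]) : conjc (a * b) = conjc a * conjc b by exact: rmorphM.
apply/funext => s; rewrite /mult /windowed mxE nth0 cM character_expi.
rewrite expi_conj -!mulrA; do 2 congr (_ * _); rewrite mulrC; congr (_ * expi (- _)).
by apply: eq_bigr => i _; rewrite coordE mxE.
Qed.

(** The first frequency coordinate is left out: a merely continuous multiplier destroys decay there,
    while decay in the others survives. *)
Definition stft_weight x xi : R :=
  (\prod_(i < m.+1) decay 2 (x 0 i)) * \prod_(i < m) decay 1 (coord xi i.+1).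

Lemma stft_weight_ge0 x xi : 0 <= stft_weight x xi.
Proof. by rewrite mulr_ge0 // prodr_ge0 // => i _; exact: decay_ge0. Qed.

Lemma stft_slice_smooth gamma : schwartz gamma -> exists2 M : R, 0 <= M &
  forall x xi, smooth_decay (M * stft_weight x xi) (stft_slice gamma x xi).
Proof.
move=> /windowed_tame [C C0 tC]; exists (C * osc_const ^+ m).
  by rewrite mulr_ge0 // exprn_ge0 // osc_const_ge0.
move=> x xi; have := tame_partial_transform (fun i => coord xi i.+1) (tC x).
by congr smooth_decay; rewrite /stft_weight; ring.
Qed.

Lemma stft_multE gamma u (c : R) x xi : schwartz gamma -> ccontinuous u ->
  (forall r, cmod (u r) <= c) -> stft gamma (mult u gamma) x xi = stft_mult gamma u x xi.
Proof.
move=> sg cu uc; have [C C0 tC] := windowed_tame sg.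
have [h E] := tame_iint_mult (coord xi) (tC x) cu uc.
by rewrite /stft cint_iint stft_integrand.
Qed.

Lemma cdecay_slice gamma x xi (a : R) : schwartz gamma ->
  cdecay (fun r => expi (a * r) * stft_slice gamma x xi r).
Proof.
move=> /stft_slice_smooth [M M0 sM]; apply: (cdecayM (ccontinuous_expi _) (b := 1)).
  by move=> r; rewrite cmod_expi.
exact: smooth_decay_cdecay (sM x xi).
Qed.

(** [V_gamma gamma] with the first frequency coordinate replaced by [tau]. For the window modulated
    by frequency [lambda] in the first variable, [tau] becomes the first coordinate of [xi] minus
    [lambda]. *)
Definition modulated_stft gamma x xi (tau : R) : R[i] :=
  cint1 (fun r => expi (- tau * r) * stft_slice gamma x xi r).

Definition trig (S : seq (R[i] * R)) : R -> R[i] :=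
  fun r => \sum_(a <- S) a.1 * expi (a.2 * r).

Lemma trig_cons a S r : trig (a :: S) r = a.1 * expi (a.2 * r) + trig S r.
Proof. by rewrite /trig big_cons. Qed.

Lemma trig_cat S1 S2 r : trig (S1 ++ S2) r = trig S1 r + trig S2 r.
Proof. by rewrite /trig big_cat. Qed.

Lemma trig_continuous S : ccontinuous (trig S).
Proof.
elim: S => [|a S IH].
  have := ccontinuous_cst (0 : R[i]); congr ccontinuous; apply/funext => r.
  by rewrite /trig big_nil.
have -> : trig (a :: S) = (fun r => a.1 * expi (a.2 * r) + trig S r).
  by apply/funext => r; rewrite trig_cons.
apply: ccontinuousD IH; apply: ccontinuousM (ccontinuous_expi _).
exact: ccontinuous_cst.
Qed.

Lemma trig_bounded S r : cmod (trig S r) <= \sum_(a <- S) cmod a.1.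
Proof.
apply: le_trans (cmod_sum _ _) _.
by apply: ler_sum => a _; rewrite cmodM cmod_expi mulr1.
Qed.

Lemma stft_multD gamma u v (c d : R) x xi : schwartz gamma ->
  ccontinuous u -> ccontinuous v -> (forall r, cmod (u r) <= c) ->
  (forall r, cmod (v r) <= d) ->
  stft_mult gamma (fun r => u r + v r) x xi = stft_mult gamma u x xi + stft_mult gamma v x xi.
Proof.
move=> sg cu cv uc vd; rewrite /stft_mult -cint1D.
- by congr cint1; apply/funext => r; rewrite mulrDl.
- exact: cdecayM cu uc (cdecay_slice _ _ _ sg).
- exact: cdecayM cv vd (cdecay_slice _ _ _ sg).
Qed.

Lemma stft_mult_trig gamma S x xi : schwartz gamma ->
  stft_mult gamma (trig S) x xi =
  \sum_(a <- S) a.1 * modulated_stft gamma x xi (coord xi 0 - a.2).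
Proof.
move=> sg; elim: S => [|a S IH].
  rewrite big_nil /stft_mult.
  have := cint1Z 0 (cdecay_slice x xi 0 sg); rewrite mul0r => E.
  rewrite -[RHS]E; congr cint1; apply/funext => r; by rewrite /trig big_nil !mul0r.
have -> : trig (a :: S) = (fun r => a.1 * expi (a.2 * r) + trig S r).
  by apply/funext => r; rewrite trig_cons.
rewrite (@stft_multD _ _ _ (cmod a.1) (\sum_(b <- S) cmod b.1)) //.
- rewrite big_cons IH; congr (_ + _); rewrite /stft_mult /modulated_stft.
  rewrite -cint1Z; last exact: cdecay_slice.
  congr cint1; apply/funext => r; rewrite -mulrA; congr (_ * _).
  by rewrite mulrA -expiD; congr (expi _ * _); ring.
- apply: ccontinuousM (ccontinuous_expi _); exact: ccontinuous_cst.
- exact: trig_continuous.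
- by move=> r; rewrite cmodM cmod_expi mulr1.
- exact: trig_bounded.
Qed.

(** Two regimes: a single character gains decay in the distance to its frequency, whereas a
    continuous remainder is controlled by its sup norm alone. *)
Lemma stft_bounds gamma : schwartz gamma -> exists2 M : R, 0 <= M &
  (forall x xi tau, cmod (modulated_stft gamma x xi tau) <=
     M * stft_weight x xi * decay 1 tau) /\
  (forall u (c : R) x xi, ccontinuous u -> (forall r, cmod (u r) <= c) ->
     cmod (stft_mult gamma u x xi) <= c * M * stft_weight x xi).
Proof.
move=> sg; have [M M0 sM] := stft_slice_smooth sg.
have m0 := @decay_mass_ge0 R.
exists (M * (8 * decay_mass)); first by rewrite !mulr_ge0.
split=> [x xi tau|u c x xi cu uc].
  apply: le_trans (cmod_cint1_expi tau (sM x xi)) _.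
  by rewrite le_eqVlt; apply/orP; left; apply/eqP; ring.
have w0 := stft_weight_ge0 x xi.
have c0 : 0 <= c := le_trans (cmod_ge0 _) (uc 0).
apply: (@le_trans _ _ ((c * (M * stft_weight x xi)) * (2 * decay_mass))).
  apply: cmod_cint1_le; first exact: cdecayM cu uc (cdecay_slice _ _ _ sg).
  move=> r; rewrite !cmodM cmod_expi mul1r -mulrA; apply: ler_pM; rewrite ?cmod_ge0 //.
  exact: (sM x xi).1.
have : 0 <= c * M * stft_weight x xi * decay_mass by do 3!apply: mulr_ge0 => //.
lra.
Qed.

Lemma modulated_stftE gamma x xi (tau : R) : schwartz gamma ->
  let z i := if i is 0 then tau else coord xi i in
  let F s := windowed gamma x s * character m.+1 z s in
  iintegrable m.+1 F /\ modulated_stft gamma x xi tau = iint m.+1 F.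
Proof.
move=> sg z F; have [C C0 tC] := windowed_tame sg.
have u1 (r : R) : cmod (1 : R[i]) <= 1 by rewrite -(@expi0 R) cmod_expi.
have [_ E] := tame_iint_mult z (tC x) (ccontinuous_cst 1) u1.
split; first exact: (tame_iint z (tC x)).1.
rewrite /modulated_stft; transitivity (iint m.+1 (fun s => 1 * F s)); last first.
  by congr iint; apply/funext => s; rewrite mul1r.
by rewrite E; congr cint1; apply/funext => r; rewrite mul1r.
Qed.

(** The value at the origin is the integral of [|gamma|^2], and the Lipschitz bound keeps [|gamma|]
    above half of [|gamma t0|] on a box around [t0]. *)
Lemma Re_iint_window_gt0 gamma : schwartz gamma -> (exists t, gamma t != 0) ->
  0 < complex.Re (modulated_stft gamma 0 0 0).
Proof.
move=> sg [t0 g0]; have [hi ->] := modulated_stftE 0 0 0 sg.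
have [L L0 gL] := schwartz_lipschitz sg.
have [hr _] := iterint_Re_Im hi.
rewrite -lte_fin -hr.
pose a := cmod (gamma t0).
have a0 : 0 < a.
  rewrite lt_neqAle cmod_ge0 andbT eq_sym; apply: contra g0 => /eqP.
  by rewrite /a cmod_normc => /ComplexField.Normc.eq0_normc ->.
have L1 : 0 < 2 * (L * m.+1%:R + 1) by rewrite mulr_gt0 // ltr_pwDr // mulr_ge0.
(* On a box of half-width [d] the window varies by at most [L * m.+1 * d <= a / 2]; the added 1
   keeps the denominator positive when [L = 0]. *)
pose d := a / (2 * (L * m.+1%:R + 1)); have d0 : 0 < d by rewrite divr_gt0.
have E s : complex.Re (windowed gamma 0 s *
    character m.+1 (fun i => if i is 0 then 0 else coord (0 : rV) i) s) =
    cmod (gamma (rowOfSeq m.+1 s)) ^+ 2.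
  rewrite character0 => [|[[|i] hi'] //=]; last first.
    by rewrite /coord; case: insub => // j; rewrite mxE.
  rewrite mulr1 /windowed subr0 cmod_sqr.
  by case: (gamma _) => p q /=; rewrite mulrN opprK.
have F0 s : (0 <= (complex.Re (windowed gamma 0 s *
    character m.+1 (fun i => if i is 0 then 0 else coord (0 : rV) i) s))%:E)%E.
  by rewrite lee_fin E sqr_ge0.
have ab i : coord t0 i - d <= coord t0 i + d by rewrite lerD2l; lra.
have c0 : 0 <= (a / 2) ^+ 2 by rewrite sqr_ge0.
apply: (lt_le_trans _ (@iterint_box_ge R m.+1 _ _ _ _ ab c0 F0 _)).
  rewrite lte_fin mulr_gt0 ?exprn_gt0 ?divr_gt0 // prodr_gt0 // => i _; lra.
move=> s sz H; rewrite lee_fin E.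
apply: lerXn2r; rewrite ?nnegrE ?cmod_ge0 ?divr_ge0 ?(ltW a0) //.
have := gL t0 (rowOfSeq m.+1 s - t0); rewrite subrKC => G.
have G2 : L * \sum_(i < m.+1) `|(rowOfSeq m.+1 s - t0) 0 i| <= a / 2.
  apply: (@le_trans _ _ (L * \sum_(i < m.+1) d)).
    rewrite ler_wpM2l // ler_sum // => i _; rewrite !mxE.
    by have := H i (ltn_ord i); rewrite coordE ler_norml; lra.
  rewrite sumr_const card_ord -[d *+ _]mulr_natr /d.
  have -> : L * (a / (2 * (L * m.+1%:R + 1)) * m.+1%:R) =
      (a / 2) * (L * m.+1%:R / (L * m.+1%:R + 1)).
    by field; rewrite !gt_eqF //; lra.
  rewrite ler_piMr ?divr_ge0 ?(ltW a0) // ler_pdivrMr; last by lra.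
  by rewrite mul1r lerDl.
have := cmod_leB (gamma (rowOfSeq m.+1 s)) (gamma (rowOfSeq m.+1 s) - gamma t0).
by rewrite opprB subrKC -/a; lra.
Qed.

(** A quantitative form of continuity at the origin. The change of the integrand is at most a
    multiple of [r * P], where [P] is the product of the [1 + |t_i|]; this factor costs one power of
    decay per coordinate, so three powers are taken for [gamma] and two remain for integration. *)
Lemma modulated_stft_lower gamma : schwartz gamma -> (exists t, gamma t != 0) ->
  exists c r : R, [/\ 0 < c, 0 < r & forall x xi tau, (forall i, `|x 0 i| <= r) ->
    (forall i : 'I_m, `|coord xi i.+1| <= r) -> `|tau| <= r ->
    c <= cmod (modulated_stft gamma x xi tau)].
Proof.
move=> sg g0; have k0 := Re_iint_window_gt0 sg g0.
have [L L0 gL] := schwartz_lipschitz sg.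
have [C C0 gC] := schwartz_decay 3 sg.
set k := complex.Re _ in k0.
pose C' := C * m.+1%:R * (2 * C + L).
have C'0 : 0 <= C' by rewrite !mulr_ge0 // addr_ge0 // mulr_ge0.
pose D := C' * (2 * decay_mass) ^+ m.+1.
have D0 : 0 <= D by rewrite mulr_ge0 // exprn_ge0 // mulr_ge0 // decay_mass_ge0.
(* The deviation from the value at the origin will be at most [r * D], hence at most [k / 2]. *)
pose r := k / (2 * (D + 1)); have r0 : 0 < r by rewrite divr_gt0 // mulr_gt0 // ltr_pwDr.
exists (k / 2), r; split=> //; first by rewrite divr_gt0.
move=> x xi tau xr xir taur.
have [i1 E1] := modulated_stftE x xi tau sg.
have [i0 E0] := modulated_stftE 0 0 0 sg.
set z := (fun i : nat => if i is 0 then tau else coord xi i) in i1 E1.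
set z0 := (fun i : nat => if i is 0 then 0 else coord 0 i) in i0 E0.
have zr (i : 'I_m.+1) : `|z i| <= r.
  by case: i => [[|i] hi] //=; exact: (xir (Ordinal (hi : (i < m)%N))).
have z00 (i : 'I_m.+1) : z0 i = 0.
  by case: i => [[|i] hi] //=; rewrite /coord; case: insub => // j; rewrite mxE.
have [h1 _] := iintZ (-1) i0; have [h2 _] := iintD i1 h1.
have Hd : cmod (modulated_stft gamma x xi tau - modulated_stft gamma 0 0 0) <= r * D.
  rewrite E1 E0 -iintB // /D mulrA; apply: cmod_iint_le.
  - by rewrite mulr_ge0 // ltW.
  - by move: h2; congr (iintegrable _ _); apply/funext => s; rewrite mulN1r.
  move=> s sz; set t := rowOfSeq m.+1 s.
  have tE i : t 0 i = nth 0 s i by rewrite mxE.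
  pose P := \prod_(i < m.+1) (1 + `|nth 0 s i|).
  have c0 : character m.+1 z0 s = 1.
    exact: character0.
  have le1 (i : 'I_m.+1) : `|nth 0 s i| <= P.
    rewrite /P (bigD1 i) //=.
    apply: (@le_trans _ _ ((1 + `|nth 0 s i|) * 1)); first by rewrite mulr1 lerDr.
    rewrite ler_wpM2l ?addr_ge0 //.
    elim/big_ind: _ => // [p q p1 q1|j _]; last by rewrite lerDl.
    by rewrite -[leLHS]mulr1 ler_pM.
  have P1' : 1 <= P.
    rewrite /P; elim/big_ind: _ => // [p q p1 q1|j _]; last by rewrite lerDl.
    by rewrite -[leLHS]mulr1 ler_pM.
  have cP : cmod (character m.+1 z s - 1) <= 2 * (r * m.+1%:R * P).
    rewrite character_expi (le_trans (cmod_expi_sub1 _)) // normrN ler_wpM2l //.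
    rewrite (le_trans (ler_norm_sum _ _ _)) // mulrAC mulr_natr -[in leRHS](card_ord m.+1).
    rewrite -sumr_const ler_sum // => i _; rewrite normrM.
    by apply: ler_pM.
  have gP : cmod (gamma (t - x) - gamma t) <= L * (r * m.+1%:R * P).
    rewrite (le_trans (gL _ _)) // ler_wpM2l //.
    apply: (@le_trans _ _ (r * m.+1%:R)); last first.
      by rewrite ler_peMr // mulr_ge0 // ltW.
    rewrite mulr_natr -[in leRHS](card_ord m.+1) -sumr_const ler_sum // => i _.
    by rewrite mxE normrN.
  have gx : cmod (gamma (t - x)) <= C.
    by rewrite (le_trans (gC _)) // ler_piMr // prod_decay_le1.
  have -> : windowed gamma x s * character m.+1 z s - windowed gamma 0 s * character m.+1 z0 s =
     gamma t * (conjc (gamma (t - x)) * (character m.+1 z s - 1) + conjc (gamma (t - x) - gamma t)).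
    by rewrite c0 /windowed subr0 (rmorphB conjc) -/t; ring.
  rewrite cmodM.
  apply: (@le_trans _ _ (C * (\prod_(i < m.+1) decay 3 (nth 0 s i)) *
      (C * (2 * (r * m.+1%:R * P)) + L * (r * m.+1%:R * P)))).
    apply: ler_pM; rewrite ?cmod_ge0 //.
      by rewrite (le_trans (gC _)) // ler_wpM2l // ler_prod // => i _; rewrite tE decay_ge0 lexx.
    rewrite (le_trans (cmod_leD _ _)) // cmodM !cmod_conjc lerD //.
    by apply: ler_pM; rewrite ?cmod_ge0.
  have -> : \prod_(i < m.+1) decay 2 (nth 0 s i) =
      (\prod_(i < m.+1) decay 3 (nth 0 s i)) * P.
    rewrite /P -big_split /=; apply: eq_bigr => i _.
    by rewrite (decayD 2 1) -mulrA /decay expr1 mulVf ?mulr1 // gt_eqF // onepnorm_gt0.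
  by rewrite le_eqVlt; apply/orP; left; apply/eqP; rewrite /C'; ring.
have rD : r * D <= k / 2.
  rewrite /r; have -> : k / (2 * (D + 1)) * D = (k / 2) * (D / (D + 1)).
    by field; rewrite gt_eqF // ltr_pwDr.
  rewrite ler_piMr ?divr_ge0 ?(ltW k0) // ler_pdivrMr ?ltr_pwDr //.
  by rewrite mul1r lerDl.
have kJ : k <= cmod (modulated_stft gamma 0 0 0).
  by rewrite (le_trans _ (normr_Re_le _)) // ler_norm.
have := cmod_triangleB (modulated_stft gamma 0 0 0)
  (modulated_stft gamma x xi tau - modulated_stft gamma 0 0 0).
by rewrite subrKC; lra.
Qed.

End ShortTimeFourier.

(** * Upper and lower bounds for the modulation norm *)

Section ModulationNorm.
Context {R : realType} {m : nat}.
Local Notation rV := 'rV[R]_m.+1.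
Let mu := @lebesgue_measure R.
Implicit Types (gamma f : rV -> R[i]) (x xi : rV).

Lemma coord_rowOfSeq (s : seq R) i : (i < m.+1)%N -> coord (rowOfSeq m.+1 s) i = nth 0 s i.
Proof. by move=> im; have := coordE (rowOfSeq m.+1 s) (Ordinal im); rewrite mxE. Qed.

Lemma powR_mul_invr (c W p : R) : 0 <= c -> 0 <= W -> 0 < p ->
  (c `^ p * W) `^ p^-1 = c * W `^ p^-1.
Proof.
move=> c0 W0 p0; rewrite powRM ?powR_ge0 // -powRrM divff ?gt_eqF // powRr1 //.
Qed.

Lemma poweR_le (a b : \bar R) (r : R) : 0 <= r -> (0 <= a)%E -> (a <= b)%E ->
  (poweR a r <= poweR b r)%E.
Proof.
move=> r0 a0 ab; apply: gt0_ler_poweR => //; rewrite in_itv /= ?leey ?andbT //.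
exact: le_trans a0 ab.
Qed.

(** A product weight at most 1 dominates its p-th power, so the inner norm is a constant times
    [B xi]. The product majorant of [B ^ q] makes the outer integral factor; [g] is left free
    because the window and its Rudin-Shapiro multiple need different functions of the first
    frequency. *)
Lemma modnorm_upper gamma (p q : R) : 1 < p -> 1 < q -> exists2 K : R, 0 <= K &
  forall f (B : rV -> R) (c : R) (g : nat -> R -> R) (I : nat -> R),
  (forall x xi, cmod (stft gamma f x xi) <= B xi * \prod_(i < m.+1) decay 2 (x 0 i)) ->
  (forall xi, 0 <= B xi) ->
  (forall i, measurable_fun [set: measurableTypeR R] (g i)) -> (forall i y, 0 <= g i y) ->
  (forall i, (\int[mu]_y (g i y)%:E)%E = (I i)%:E) -> 0 <= c ->
  (forall xi, B xi `^ q <= c * \prod_(i < m.+1) g i (coord xi i)) ->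
  (modnorm gamma p q f <= ((K * c * \prod_(i < m.+1) I i) `^ q^-1)%:E)%E.
Proof.
move=> p1 q1; have p0 : 0 < p by lra. have q0 : 0 < q by lra.
have dm0 := @decay_mass_ge0 R.
pose W : R := \prod_(i < m.+1) decay_mass.
have W0 : 0 <= W by apply: prodr_ge0.
exists ((W `^ p^-1) `^ q); first exact: powR_ge0.
move=> f B c g I VB B0 mg g0 gI c0 Bg.
have inner xi : (intRn (fun x => (powR (cmod (stft gamma f x xi)) p)%:E) <=
    (B xi `^ p * W)%:E)%E.
  rewrite -(@iterint_prod R m.+1 (fun=> decay 2) (fun=> decay_mass)).
  - apply: iterint_le => [s|s sz]; rewrite lee_fin ?powR_ge0 //.
    have P0 : 0 <= \prod_(i < m.+1) decay 2 (rowOfSeq m.+1 s 0 i).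
      by apply: prodr_ge0 => i _; exact: decay_ge0.
    apply: (@le_trans _ _ ((B xi * \prod_(i < m.+1) decay 2 (rowOfSeq m.+1 s 0 i)) `^ p)).
      by apply: ge0_ler_powR; rewrite ?nnegrE ?cmod_ge0 ?mulr_ge0 ?(ltW p0).
    rewrite powRM // ler_wpM2l ?powR_ge0 //.
    have PE : \prod_(i < m.+1) decay 2 (rowOfSeq m.+1 s 0 i) =
        \prod_(i < m.+1) decay 2 (nth 0 s i) by apply: eq_bigr => i _; rewrite mxE.
    rewrite PE ge1r_powR ?(ltW p1) // prod_decay_le1 andbT prodr_gt0 // => i _.
    exact: decay_gt0.
  - by move=> i; apply: continuous_measurable_fun; exact: decay_continuous.
  - by move=> i x; exact: decay_ge0.
  - by move=> i; exact: integral_decayE.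
  - exact: powR_ge0.
rewrite /modnorm -poweR_EFin; apply: poweR_le; rewrite ?invr_ge0 ?(ltW q0) //.
  by apply: iterint_ge0 => s; exact: poweR_ge0.
rewrite -(@iterint_prod R m.+1 g I) //; last by rewrite mulr_ge0 ?powR_ge0.
apply: iterint_le => [s|s sz]; first exact: poweR_ge0.
set xi := rowOfSeq m.+1 s.
have i0 : (0 <= intRn (fun x => (powR (cmod (stft gamma f x xi)) p)%:E))%E.
  by apply: iterint_ge0 => s'; rewrite lee_fin powR_ge0.
have := poweR_le (ltW q0) (poweR_ge0 _ _)
  (poweR_le (_ : 0 <= p^-1) i0 (inner xi)).
rewrite !poweR_EFin powR_mul_invr // powRM ?powR_ge0 // => /(_ _)/le_trans; apply.
  by rewrite invr_ge0 ltW.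
rewrite lee_fin mulrC -mulrA ler_wpM2l ?powR_ge0 // (le_trans (Bg xi)) //.
rewrite ler_wpM2l // ler_prod // => i _; rewrite g0 /=.
by rewrite coord_rowOfSeq ?ltn_ord.
Qed.

Lemma integral_sum_indic (N : nat) (lam : nat -> R) (r : R) : 0 <= r ->
  (\int[mu]_y (\sum_(j < N) \1_(`[(lam j - r)%R, (lam j + r)%R]%classic : set R) y)%:E
    = (N%:R * (2 * r))%:E)%E.
Proof.
move=> r0; under eq_integral do rewrite -sumEFin.
rewrite ge0_integral_sum //.
- rewrite (eq_bigr (fun=> (2 * r)%:E)) => [|j _].
    by rewrite sumEFin; congr EFin; rewrite sumr_const card_ord -[LHS]mulr_natl.
  by rewrite integral_indic_itv; [congr EFin; ring|lra].
- by move=> j; apply/measurable_EFinP; exact: measurable_indic.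
Qed.

(** The separation of the [lam j] makes the frequency boxes disjoint, so the sum of their indicators
    is at most 1 and is a legitimate minorant; each of the [N] boxes contributes the same mass. *)
Lemma modnorm_lower gamma (p q r : R) : 1 < p -> 1 < q -> 0 < r -> exists2 K : R, 0 < K &
  forall f (N : nat) (lam : nat -> R) (c : R), 0 <= c ->
  (forall j k, (j < N)%N -> (k < N)%N -> j != k -> 2 * r < `|lam j - lam k|) ->
  (forall x xi j, (j < N)%N -> (forall i, `|x 0 i| <= r) -> `|coord xi 0 - lam j| <= r ->
     (forall i : 'I_m, `|coord xi i.+1| <= r) -> c <= cmod (stft gamma f x xi)) ->
  (((K * c `^ q * N%:R) `^ q^-1)%:E <= modnorm gamma p q f)%E.
Proof.
move=> p1 q1 r0; have p0 : 0 < p by lra. have q0 : 0 < q by lra.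
pose W : R := \prod_(i < m.+1) (r - - r).
have W0 : 0 < W by apply: prodr_gt0 => i _; lra.
have w0 : 0 < (W `^ p^-1) `^ q by rewrite !powR_gt0.
pose V : R := \prod_(i < m) (r - - r).
have V0 : 0 < V by apply: prodr_gt0 => i _; lra.
exists ((W `^ p^-1) `^ q * (2 * r) * V); first by rewrite !mulr_gt0.
move=> f N lam c c0 sep H.
rewrite /modnorm -poweR_EFin; apply: poweR_le; rewrite ?invr_ge0 ?(ltW q0) //.
  by rewrite lee_fin !mulr_ge0 ?powR_ge0 ?(ltW V0) ?(ltW r0).
pose g (i : nat) : R -> R := if i is 0
  then (fun y => \sum_(j < N) \1_(`[(lam j - r)%R, (lam j + r)%R]%classic : set R) y)
  else \1_(`[- r, r]%classic : set R).
pose I (i : nat) : R := if i is 0 then N%:R * (2 * r) else r - - r.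
have mg i : measurable_fun [set: measurableTypeR R] (g i).
  case: i => [|i]; last exact: measurable_indic.
  by apply: measurable_sum => j; exact: measurable_indic.
have g0 i y : 0 <= g i y by case: i => [|i] //; apply: sumr_ge0.
have gI i : (\int[mu]_y (g i y)%:E)%E = (I i)%:E.
  case: i => [|i] /=; first by rewrite integral_sum_indic // ltW.
  by rewrite integral_indic_itv //; lra.
have k0 : 0 <= (W `^ p^-1) `^ q * c `^ q by rewrite mulr_ge0 ?powR_ge0.
have PI : \prod_(i < m.+1) I i = N%:R * (2 * r) * V by rewrite big_ord_recl.
have E := iterint_prod m.+1 mg g0 gI k0; rewrite PI in E.
have -> : (W `^ p^-1) `^ q * (2 * r) * V * c `^ q * N%:R =
   (W `^ p^-1) `^ q * c `^ q * (N%:R * (2 * r) * V) by ring.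
rewrite -E; apply: iterint_le => [s|s sz].
  by rewrite lee_fin mulr_ge0 // prodr_ge0.
set xi := rowOfSeq m.+1 s.
have [/forallP Hi|/forallPn [i Hi]] := boolP [forall i : 'I_m, `|nth 0 s i.+1| <= r];
    last first.
  rewrite (bigD1 (lift ord0 i)) //= /bump /= add1n indicE memNset ?mul0r ?mulr0 ?poweR_ge0 //.
  by rewrite /= in_itv /= -ler_norml; exact/negP.
have [/existsP [j Hj]|/existsPn Hn] := boolP [exists j : 'I_N, `|nth 0 s 0 - lam j| <= r];
    last first.
  rewrite big_ord_recl /= big1 ?mul0r ?mulr0 ?poweR_ge0 // => j _.
  rewrite indicE memNset // /= in_itv /= => h; have /negP := Hn j; apply.
  by rewrite ler_norml; move: h; lra.
have -> : \prod_(i < m.+1) g i (nth 0 s i) = 1.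
  rewrite big_ord_recl /= [X in _ * X]big1 ?mulr1 => [|i _]; last first.
    by rewrite /bump /= indicE mem_set //= in_itv /= -ler_norml; exact: Hi.
  rewrite (bigD1 j) //= big1 ?addr0 => [|k kj].
    rewrite indicE mem_set //= in_itv /=; move: Hj; rewrite ler_norml; lra.
  rewrite indicE memNset //= in_itv /= => h.
  have := sep k j (ltn_ord k) (ltn_ord j) kj.
  by rewrite ltNge ler_norml; move: h Hj; rewrite ler_norml; lra.
rewrite mulr1.
have inner : ((c `^ p * W)%:E <= intRn (fun x => (powR (cmod (stft gamma f x xi)) p)%:E))%E.
  have := @iterint_box_ge R m.+1 (fun s => (powR (cmod (stft gamma f (rowOfSeq m.+1 s) xi)) p)%:E)
    (fun=> - r) (fun=> r) (c `^ p); apply.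
  - by move=> _; lra.
  - exact: powR_ge0.
  - by move=> s'; rewrite lee_fin powR_ge0.
  move=> s' sz' Hs'; rewrite lee_fin.
  apply: ge0_ler_powR; rewrite ?nnegrE ?cmod_ge0 ?(ltW p0) //.
  apply: (H _ _ j) => //.
  - by move=> i; rewrite mxE ler_norml; exact: Hs'.
  - by rewrite coord_rowOfSeq.
  - by move=> i; rewrite coord_rowOfSeq ?ltnS ?ltn_ord //; exact: Hi.
have i0 : (0 <= (c `^ p * W)%:E)%E by rewrite lee_fin mulr_ge0 ?powR_ge0 ?(ltW W0).
have pV : 0 <= p^-1 by rewrite invr_ge0 ltW.
have := poweR_le (ltW q0) (poweR_ge0 _ _) (poweR_le pV i0 inner).
rewrite !poweR_EFin powR_mul_invr ?(ltW W0) // powRM ?powR_ge0 //.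
by rewrite mulrC.
Qed.

End ModulationNorm.

(** * Rudin-Shapiro polynomials *)

Section RudinShapiro.
Context {R : realType}.

(** Coefficient lists of the Rudin-Shapiro recursion, which sends [P], [Q] to [P + z^(2^a) Q] and
    [P - z^(2^a) Q]; concatenation implements the multiplication by [z^(2^a)]. *)
Fixpoint rs_pair (a : nat) : seq R * seq R := match a with
  | 0 => ([:: 1], [:: 1])
  | a'.+1 => let (P, Q) := rs_pair a' in (P ++ Q, P ++ map -%R Q)
  end.

Definition rs (a : nat) : seq R := (rs_pair a).1.

Lemma size_rs_pair a : size (rs_pair a).1 = (2 ^ a)%N /\ size (rs_pair a).2 = (2 ^ a)%N.
Proof.
elim: a => [//|a] /=; case: (rs_pair a) => P Q /= [hP hQ].
by rewrite !size_cat size_map hP hQ addnn expnS mul2n.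
Qed.

Lemma size_rs a : size (rs a) = (2 ^ a)%N.
Proof. by have [] := size_rs_pair a. Qed.

Lemma rs_pair_unit a : all (fun e => `|e| == 1) (rs_pair a).1 /\
  all (fun e => `|e| == 1) (rs_pair a).2.
Proof.
elim: a => [|a] /=; first by rewrite normr1 eqxx.
case: (rs_pair a) => P Q /= [hP hQ]; rewrite !all_cat hP hQ all_map /=.
by split=> //; apply: sub_all hQ => e /=; rewrite normrN.
Qed.

Lemma rs_unit a j : (j < 2 ^ a)%N -> `|nth 0 (rs a) j| = 1.
Proof.
move=> ja; have [h _] := rs_pair_unit a.
by apply/eqP; apply: (all_nthP 0 h); rewrite -/(rs a) size_rs.
Qed.

Definition seq_trig (es : seq R) (th : R) : R[i] :=
  \sum_(j < size es) Complex (nth 0 es j) 0 * expi (j%:R * th).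

Lemma seq_trig_cat es fs th : seq_trig (es ++ fs) th =
  seq_trig es th + expi ((size es)%:R * th) * seq_trig fs th.
Proof.
rewrite /seq_trig size_cat big_split_ord /=; congr (_ + _).
  by apply: eq_bigr => j _; rewrite nth_cat ltn_ord.
rewrite mulr_sumr; apply: eq_bigr => j _; rewrite nth_cat ltnNge leq_addr /= addKn.
by rewrite mulrCA -expiD; congr (_ * expi _); rewrite natrD; ring.
Qed.

Lemma seq_trig_opp es th : seq_trig (map -%R es) th = - seq_trig es th.
Proof.
rewrite /seq_trig size_map -sumrN; apply: eq_bigr => j _.
rewrite (nth_map 0) // -mulNr; congr (_ * _).
by apply/eqP; rewrite eq_complex /= oppr0 !eqxx.
Qed.

Lemma parallelogram (z y : R[i]) :
  cmod (z + y) ^+ 2 + cmod (z - y) ^+ 2 = 2 * (cmod z ^+ 2 + cmod y ^+ 2).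
Proof. by rewrite !cmod_sqr !(cReD, cImD, cReN, cImN); ring. Qed.

(** As [z^(2^a)] has modulus 1, the parallelogram law doubles the sum of the squares at each
    stage. *)
Lemma rs_pair_flat a th :
  cmod (seq_trig (rs_pair a).1 th) ^+ 2 + cmod (seq_trig (rs_pair a).2 th) ^+ 2 =
  2 ^+ a.+1.
Proof.
elim: a => [|a] /=.
  rewrite /seq_trig !big_ord1 /= mul0r expi0 mulr1 cmod_real normr1 expr1n expr1.
  by ring.
have [hP hQ] := size_rs_pair a; case: (rs_pair a) hP hQ => P Q /= hP hQ IH.
rewrite !seq_trig_cat seq_trig_opp mulrN parallelogram cmodM cmod_expi mul1r IH.
by rewrite -exprS.
Qed.

Lemma rs_flat a th : cmod (seq_trig (rs a) th) ^+ 2 <= 2 ^+ a.+1.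
Proof. by rewrite -(rs_pair_flat a th) lerDl sqr_ge0. Qed.

Definition rs_scale (a : nat) : R := (Num.sqrt (2 ^+ a.+1))^-1.

Lemma rs_scale_gt0 a : 0 < rs_scale a.
Proof. by rewrite invr_gt0 sqrtr_gt0 exprn_gt0. Qed.

(** The sum of the squared normalized coefficients, that is, the constant term of [Q] times its
    conjugate; it does not depend on the degree. *)
Lemma rs_scale_sqr a : rs_scale a ^+ 2 * 2 ^+ a = 2^-1.
Proof.
rewrite /rs_scale exprVn sqr_sqrtr ?exprn_ge0 // exprS invfM -mulrA mulVf ?mulr1 //.
Qed.

(** Frequencies start at [L] rather than at 0, so that a large [L] also keeps them away from every
    frequency used before. *)
Definition rs_trig (a : nat) (L : R) : seq (R[i] * R) :=
  [seq (Complex (rs_scale a * nth 0 (rs a) j) 0, j.+1%:R * L) | j <- iota 0 (2 ^ a)].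

Lemma trig_rs a L r : trig (rs_trig a L) r =
  \sum_(j < 2 ^ a) Complex (rs_scale a * nth 0 (rs a) j) 0 * expi (j.+1%:R * L * r).
Proof. by rewrite /trig big_map -[X in iota _ X]subn0 big_mkord. Qed.

Lemma rs_trig_bounded a L r : cmod (trig (rs_trig a L) r) <= 1.
Proof.
have -> : trig (rs_trig a L) r =
    Complex (rs_scale a) 0 * (expi (L * r) * seq_trig (rs a) (L * r)).
  rewrite trig_rs /seq_trig size_rs !mulr_sumr; apply: eq_bigr => j _.
  have -> : Complex (rs_scale a * nth 0 (rs a) j) 0 =
      Complex (rs_scale a) 0 * Complex (nth 0 (rs a) j) 0 :> R[i].
    by apply/eqP; rewrite eq_complex /= !(mul0r, mulr0) subr0 addr0 !eqxx.
  rewrite -mulrA; congr (_ * _); rewrite mulrCA -expiD; congr (_ * expi _).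
  by rewrite -natr1; ring.
rewrite !cmodM cmod_expi mul1r cmod_real ger0_norm ?(ltW (rs_scale_gt0 a)) //.
rewrite mulrC ler_pdivrMr ?sqrtr_gt0 ?exprn_gt0 // mul1r.
by rewrite -[leLHS]ger0_norm ?cmod_ge0 // -sqrtr_sqr ler_wsqrtr // rs_flat.
Qed.

(** The sign of [t - q / 2] decides between growth and decay in [a]. The value [t = 1] serves for
    [q < 2], and some [t] strictly between 1 and [q / 2] for [q > 2]. *)
Lemma rs_scale_powR a (q t : R) :
  rs_scale a `^ q * (2 ^+ a) `^ t = 2 `^ (- (q / 2)) * (2 `^ (t - q / 2)) ^+ a.
Proof.
have e2 : 0 <= 2 :> R by [].
have -> : rs_scale a = 2 `^ (- (a.+1%:R / 2)).
  by rewrite powRN powRrM powR12_sqrt ?powR_ge0 // powR_mulrn.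
rewrite -(powR_mulrn a e2) -(powR_mulrn a (powR_ge0 _ _)) -!powRrM.
rewrite -!powRD; last 2 first.
- by rewrite pnatr_eq0 implybT.
- by rewrite pnatr_eq0 implybT.
by congr (_ `^ _); rewrite -natr1; ring.
Qed.

Lemma expr_unbounded (b Z : R) : 1 < b -> exists a : nat, Z < b ^+ a.
Proof.
move=> b1; have b0 : 0 < b - 1 by rewrite subr_gt0.
have bern a : 1 + a%:R * (b - 1) <= b ^+ a.
  elim: a => [|a IH]; first by rewrite mul0r addr0.
  rewrite exprS -natr1; have : 0 <= a%:R * (b - 1) * (b - 1) by rewrite !mulr_ge0 // ltW.
  nra.
exists (Num.truncn (`|Z| / (b - 1))).+1; apply: lt_le_trans (bern _).
have := truncnS_gt (`|Z| / (b - 1)); rewrite ltr_pdivrMr // => H.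
have := ler_norm Z; lra.
Qed.

End RudinShapiro.

(** * Peaks of the short-time Fourier transform, and the norm of the window *)

Section Peaks.
Context {R : realType} {m : nat}.
Local Notation rV := 'rV[R]_m.+1.
Implicit Types (gamma f : rV -> R[i]) (u v E : R -> R[i]) (x xi : rV)
  (S : seq (R[i] * R)).

Definition l1norm S : R := \sum_(a <- S) cmod a.1.

Lemma l1norm_ge0 S : 0 <= l1norm S.
Proof. by apply: sumr_ge0 => a _; exact: cmod_ge0. Qed.

Lemma stft_weight_le1 x xi : stft_weight x xi <= 1.
Proof.
rewrite /stft_weight -[leRHS]mulr1 ler_pM ?prod_decay_le1 //.
all: by apply: prodr_ge0 => i _; exact: decay_ge0.
Qed.

Lemma decay1_le (D y : R) : 0 < D -> D <= `|y| -> decay 1 y <= D^-1.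
Proof.
move=> D0 Dy; rewrite /decay expr1 lef_pV2 ?posrE ?onepnorm_gt0 //; lra.
Qed.

(** The nearby frequency contributes at least [c * cmod a0]. Each distant term is bounded by its
    absolute value, at most its coefficient times [M / D]; the resulting l^1 norm is harmless
    because [D] can be chosen after it. *)
Lemma stft_peak gamma : schwartz gamma -> (exists t, gamma t != 0) ->
  exists c r M : R, [/\ 0 < c, 0 < r & 0 <= M] /\
  forall (a0 : R[i]) (lam : R) S E (del D : R) u x xi,
    ccontinuous E -> (forall y, cmod (E y) <= del) -> 0 < D ->
    u = (fun y => a0 * expi (lam * y) + trig S y + E y) ->
    (forall i, `|x 0 i| <= r) -> `|coord xi 0 - lam| <= r ->
    (forall i : 'I_m, `|coord xi i.+1| <= r) ->
    (forall b, b \in S -> D <= `|coord xi 0 - b.2|) ->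
    c * cmod a0 - M * (l1norm S / D + del) <= cmod (stft gamma (mult u gamma) x xi).
Proof.
move=> sg g0; have [c [r [c0 r0 lower]]] := modulated_stft_lower sg g0.
have [M M0 [up1 up2]] := stft_bounds sg; exists c, r, M; split=> //.
move=> a0 lam S E del D u x xi cE Ed D0 uE xr xi0 xir SD.
have w0 := stft_weight_ge0 x xi; have w1 := stft_weight_le1 x xi.
have tE : (fun y => a0 * expi (lam * y) + trig S y) = trig ((a0, lam) :: S).
  by apply/funext => y; rewrite trig_cons.
have cT := trig_continuous ((a0, lam) :: S).
have bT := trig_bounded ((a0, lam) :: S).
have uE' : u = (fun y => trig ((a0, lam) :: S) y + E y) by rewrite uE -tE.
have bu y : cmod (u y) <= \sum_(b <- (a0, lam) :: S) cmod b.1 + del.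
  by rewrite uE' (le_trans (cmod_leD _ _)) // lerD.
rewrite (stft_multE x xi sg _ bu); last by rewrite uE'; exact: ccontinuousD.
rewrite uE' (stft_multD x xi sg cT cE bT Ed) (stft_mult_trig _ x xi sg) big_cons /=.
set P := modulated_stft _ _ _ _; set Q := \sum_(_ <- _) _; set V := stft_mult _ _ _ _.
have hP : c <= cmod P by apply: lower.
have hV : cmod V <= M * del.
  apply: le_trans (up2 E del x xi cE Ed) _.
  by rewrite (mulrC M del) ler_piMr // mulr_ge0 // (le_trans (cmod_ge0 _) (Ed 0)).
have hQ : cmod Q <= M * (l1norm S / D).
  apply: le_trans (cmod_sum _ _) _; rewrite mulrA (mulrC M) -mulrA /l1norm mulr_suml.
  rewrite big_seq [leRHS]big_seq ler_sum // => b bS; rewrite cmodM ler_wpM2l ?cmod_ge0 //.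
  apply: le_trans (up1 x xi _) _; apply: ler_pM.
  - by rewrite mulr_ge0.
  - exact: decay_ge0.
  - by rewrite ler_piMr.
  - by rewrite decay1_le // SD.
have h1 := cmod_triangleB (a0 * P + Q) V.
have h2 := cmod_triangleB (a0 * P) Q.
have h3 : c * cmod a0 <= cmod (a0 * P) by rewrite cmodM mulrC ler_wpM2l // cmod_ge0.
by rewrite mulrDr; lra.
Qed.

(** Stated as a negated inequality between extended reals, so that an infinite norm of [u f] is
    allowed. *)
Definition defeats gamma (p q A : R) u := exists2 f, schwartz f &
  ~ (modnorm gamma p q (mult u f) <= A%:E * modnorm gamma p q f)%E.

(** With [s = q] this is where [1 < q] makes first-order decay in frequency sufficient. *)
Lemma integral_decay_powR (s : R) : 1 < s -> exists2 I : R, 0 <= I &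
  (\int[@lebesgue_measure R]_y (decay 1 y `^ s)%:E)%E = I%:E.
Proof.
move=> s1.
have I0 : (0 <= \int[@lebesgue_measure R]_y (decay 1 y `^ s)%:E)%E.
  by apply: integral_ge0 => y _; rewrite lee_fin powR_ge0.
exists (fine (\int[@lebesgue_measure R]_y (decay 1 y `^ s)%:E)%E); first exact: fine_ge0.
rewrite fineK // ge0_fin_numE //.
under eq_integral => y _.
  have -> : decay 1 y `^ s = (1 + `|y|) `^ (- s).
    rewrite /decay expr1 -powR_inv1 ?(ltW (onepnorm_gt0 y)) // -powRrM mulN1r.
    by [].
  over.
exact: integral_powR_decay_lty.
Qed.

Lemma decay_powR_measurable (s : R) (y0 : R) :
  measurable_fun [set: measurableTypeR R] (fun y => decay 1 (y + y0) `^ s).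
Proof.
apply: (measurableT_comp (measurable_powR s)).
by apply: continuous_measurable_fun; apply: continuous_shift; exact: decay_continuous.
Qed.

Lemma modnorm_window_lty gamma (p q : R) : schwartz gamma -> 1 < p -> 1 < q ->
  exists B : R, (modnorm gamma p q gamma <= B%:E)%E.
Proof.
move=> sg p1 q1; have q0 : 0 <= q by lra.
have [K K0 up] := modnorm_upper gamma p1 q1 (m := m).
have [M M0 [up1 _]] := stft_bounds sg.
have [I I0 IE] := integral_decay_powR q1.
(* The window is its own multiple by the trigonometric polynomial with the single coefficient 1 at
   frequency 0. *)
have E x xi : stft gamma gamma x xi = modulated_stft gamma x xi (coord xi 0).
  have := @stft_multE _ _ gamma (trig [:: (1, 0)]) _ x xi sg (trig_continuous _) (trig_bounded _).
  rewrite (stft_mult_trig _ _ _ sg) big_cons big_nil /= subr0 addr0 mul1r => <-.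
  congr stft; apply/funext => t; rewrite /mult /trig big_cons big_nil /=.
  by rewrite mul0r expi0 !mulr1 addr0 mul1r.
eexists; apply: (up gamma (fun xi => M * \prod_(i < m.+1) decay 1 (coord xi i)) (M `^ q)
  (fun _ y => decay 1 y `^ q) (fun=> I)).
- move=> x xi; rewrite E; apply: le_trans (up1 x xi _) _.
  by rewrite big_ord_recl /stft_weight le_eqVlt; apply/orP; left; apply/eqP; rewrite /=; ring.
- by move=> xi; rewrite mulr_ge0 // prodr_ge0 // => i _; exact: decay_ge0.
- move=> i; have := decay_powR_measurable q 0.
  by congr measurable_fun; apply/funext => y; rewrite addr0.
- by move=> i y; exact: powR_ge0.
- by [].
- exact: powR_ge0.
- move=> xi; rewrite powRM //; last by apply: prodr_ge0 => i _; exact: decay_ge0.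
  rewrite ler_wpM2l ?powR_ge0 // le_eqVlt; apply/orP; left; apply/eqP.
  elim: (index_enum _) => [|i l IH]; first by rewrite !big_nil powR1.
  rewrite !big_cons powRM ?decay_ge0 ?IH //.
  by apply: prodr_ge0 => j _; exact: decay_ge0.
Qed.

End Peaks.

(** * Stability of the Schwartz class under trigonometric multipliers *)

Section SchwartzMultipliers.
Context {R : realType} {m : nat}.
Local Notation rV := 'rV[R]_m.+1.
Implicit Types (f : rV -> R[i]) (g h : rV -> R) (t : rV).

Lemma is_derive_line h t (v : rV) (d : R) :
  is_derive (0 : R) 1 (fun r : R => h (t + r *: v)) d -> is_derive t v h d.
Proof.
have E : (fun k : R => k^-1 *: (h (t + (k *: 1 + 0) *: v) - h (t + 0 *: v))) =
    (fun k : R => k^-1 *: (h (k *: v + t) - h t)).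
  by apply/funext => k; rewrite addr0 scale0r addr0 [k%:A]mulr1 (addrC t).
by move=> [d1 d2]; split; [move: d1|move: d2]; rewrite /derivable /derive /= E.
Qed.

(** If [B] is closed under partial derivatives, so is this span, since differentiating a cosine
    shifts its phase by [pi / 2]. Derivatives of every order are thus covered by a single closure
    property in place of a higher Leibniz formula, and sines are cosines with another phase. *)
Inductive osc_span (B : (rV -> R) -> Prop) : (rV -> R) -> Prop :=
| osc_zero : osc_span B (fun=> 0)
| osc_base (a b : R) g : B g -> osc_span B (fun t => cos (a * t 0 0 + b) * g t)
| osc_lin (c : R) g h : osc_span B g -> osc_span B h -> osc_span B (fun t => c * g t + h t).

Lemma osc_span_derive (B : (rV -> R) -> Prop) :
  (forall g i t, B g -> derivable g t (delta_mx 0 i)) ->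
  (forall g i, B g -> B (fun t => 'D_(delta_mx 0 i) g t)) ->
  forall h i, osc_span B h -> (forall t, derivable h t (delta_mx 0 i)) /\
    osc_span B (fun t => 'D_(delta_mx 0 i) h t).
Proof.
move=> Bd Bc h i; elim=> [|a b g Bg|c g h' _ [dg og] _ [dh oh]].
- split=> [t|]; first exact: derivable_cst.
  have -> : (fun t : rV => 'D_(delta_mx 0 i) (fun=> 0 : R) t) = (fun=> 0 : R).
    by apply/funext => t; exact: derive_cst.
  exact: osc_zero.
- pose e : R := (i == 0)%:R.
  have D t : is_derive t (delta_mx 0 i : rV) (fun t => cos (a * t 0 0 + b) * g t)
     (a * e * (cos (a * t 0 0 + (b + pi / 2)) * g t) +
      cos (a * t 0 0 + b) * 'D_(delta_mx 0 i) g t).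
    apply: is_derive_line.
    have E : (fun r : R => cos (a * (t + r *: delta_mx 0 i) 0 0 + b) *
         g (t + r *: delta_mx 0 i)) =
        (fun r : R => cos (a * e * r + (a * t 0 0 + b)) * g (t + r *: delta_mx 0 i)).
      apply/funext => r; congr (cos _ * _); rewrite !mxE eqxx /= /e eq_sym; ring.
    rewrite E.
    have d1 : is_derive (0 : R) 1 (fun r : R => a * e * r + (a * t 0 0 + b)) (a * e).
      by apply: is_derive_eq; rewrite addr0 [_ *: 1]mulr1.
    have d2 := @is_derive1_comp R cos _ 0 _ _ (is_derive_cos _) d1.
    have d3 := @derivable_line R m.+1 g t i 0 (Bd _ _ _ Bg).
    have d4 := is_deriveM d2 d3.
    apply: (is_derive_eq d4); rewrite /= mulr0 add0r scale0r addr0.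
    by rewrite addrA cosDpihalf /GRing.scale /=; ring.
  split=> [t|]; first by have [] := D t.
  have -> : (fun t : rV => 'D_(delta_mx 0 i) (fun t => cos (a * t 0 0 + b) * g t) t) =
     (fun t => a * e * (cos (a * t 0 0 + (b + pi / 2)) * g t) +
      cos (a * t 0 0 + b) * 'D_(delta_mx 0 i) g t).
    by apply/funext => t; have [_ ->] := D t.
  by apply: osc_lin; apply: osc_base => //; exact: Bc.
- have D t : is_derive t (delta_mx 0 i : rV) (fun t => c * g t + h' t)
      (c * 'D_(delta_mx 0 i) g t + 'D_(delta_mx 0 i) h' t).
    have d1 := is_deriveZ c (derivableP (dg t)).
    exact: is_deriveD d1 (derivableP (dh t)).
  split=> [t|]; first by have [] := D t.
  have -> : (fun t : rV => 'D_(delta_mx 0 i) (fun t => c * g t + h' t) t) =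
     (fun t => c * 'D_(delta_mx 0 i) g t + 'D_(delta_mx 0 i) h' t).
    by apply/funext => t; have [_ ->] := D t.
  exact: osc_lin.
Qed.

Lemma osc_span_schwartz (B : (rV -> R) -> Prop) :
  (forall g i t, B g -> derivable g t (delta_mx 0 i)) ->
  (forall g i, B g -> B (fun t => 'D_(delta_mx 0 i) g t)) ->
  (forall g (N : nat), B g -> exists C : R, forall t, (1 + enorm t) ^+ N * `|g t| <= C) ->
  forall h, osc_span B h -> schwartz_real h.
Proof.
move=> Bd Bc BN h oh.
have op ds : osc_span B (pder ds h).
  elim: ds => [//|i ds IH] /=.
  exact: (osc_span_derive Bd Bc i IH).2.
split=> [ds i t|ds N]; first exact: (osc_span_derive Bd Bc i (op ds)).1.
elim: (op ds) => [|a b g Bg|c g h' _ [C1 H1] _ [C2 H2]].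
- by exists 0 => t; rewrite normr0 mulr0.
- have [C HC] := BN g N Bg; exists C => t; apply: le_trans (HC t).
  rewrite ler_wpM2l ?exprn_ge0 ?addr_ge0 ?sqrtr_ge0 // normrM ler_piMl //.
  by rewrite ler_norml cos_geN1 cos_le1.
- exists (`|c| * C1 + C2) => t.
  apply: (@le_trans _ _ (`|c| * ((1 + enorm t) ^+ N * `|g t|) + (1 + enorm t) ^+ N * `|h' t|)).
    rewrite mulrCA -normrM -mulrDr ler_wpM2l ?ler_normD //.
    by rewrite exprn_ge0 // addr_ge0 // sqrtr_ge0.
  by rewrite lerD // ler_wpM2l.
Qed.

Lemma schwartz_mult_trig f S : schwartz f -> schwartz (mult (trig S) f).
Proof.
move=> [sr si].
(* All partial derivatives of the real and imaginary parts of [f]: a family closed under derivatives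
   and rapidly decreasing by assumption. *)
pose B (g : rV -> R) := exists ds, g = pder ds (fun t => complex.Re (f t)) \/
  g = pder ds (fun t => complex.Im (f t)).
have H : forall h, osc_span B h -> schwartz_real h.
  apply: osc_span_schwartz.
  - by move=> g i t [ds [->|->]]; [exact: sr.1|exact: si.1].
  - by move=> g i [ds [->|->]]; exists (i :: ds); [left|right].
  - by move=> g N [ds [->|->]]; [exact: sr.2|exact: si.2].
have Br : B (fun t => complex.Re (f t)) by exists [::]; left.
have Bi : B (fun t => complex.Im (f t)) by exists [::]; right.
have sinE (x : R) : sin x = cos (x + - (pi / 2)) by rewrite cosBpihalf.
split; apply: H; elim: S => [|[[al be] la] S IH].
- have -> : (fun t => complex.Re (mult (trig [::]) f t)) = (fun=> 0).
    by apply/funext => t; rewrite /mult /trig big_nil mul0r.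
  exact: osc_zero.
- have -> : (fun t => complex.Re (mult (trig ((Complex al be, la) :: S)) f t)) = (fun t =>
     al * (cos (la * t 0 0 + 0) * complex.Re (f t)) +
     (- be * (cos (la * t 0 0 + - (pi / 2)) * complex.Re (f t)) +
     (- be * (cos (la * t 0 0 + 0) * complex.Im (f t)) +
     (- al * (cos (la * t 0 0 + - (pi / 2)) * complex.Im (f t)) +
     complex.Re (mult (trig S) f t))))).
    apply/funext => t; rewrite /mult trig_cons addr0 -sinE !(cReM, cReD, cImM, cImD) /=.
    by ring.
  by do 4!(apply: osc_lin; first exact: osc_base).
- have -> : (fun t => complex.Im (mult (trig [::]) f t)) = (fun=> 0).
    by apply/funext => t; rewrite /mult /trig big_nil mul0r.
  exact: osc_zero.
- have -> : (fun t => complex.Im (mult (trig ((Complex al be, la) :: S)) f t)) = (fun t =>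
     al * (cos (la * t 0 0 + 0) * complex.Im (f t)) +
     (- be * (cos (la * t 0 0 + - (pi / 2)) * complex.Im (f t)) +
     (be * (cos (la * t 0 0 + 0) * complex.Re (f t)) +
     (al * (cos (la * t 0 0 + - (pi / 2)) * complex.Re (f t)) +
     complex.Im (mult (trig S) f t))))).
    apply/funext => t; rewrite /mult trig_cons addr0 -sinE !(cReM, cReD, cImM, cImD) /=.
    by ring.
  by do 4!(apply: osc_lin; first exact: osc_base).
Qed.

End SchwartzMultipliers.

(** * The hump for q < 2 *)

Section FrequencySpread.
Context {R : realType} {m : nat}.
Local Notation rV := 'rV[R]_m.+1.
Implicit Types (gamma f : rV -> R[i]) (E : R -> R[i]) (x xi : rV)
  (S : seq (R[i] * R)).

Lemma natr_sep (j k : nat) : j != k -> 1 <= `|j.+1%:R - k.+1%:R| :> R.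
Proof.
rewrite ler_normr neq_ltn => /orP[jk|kj]; apply/orP; [right|left].
- have : j.+1%:R + 1 <= k.+1%:R :> R by rewrite natr1 ler_nat.
  lra.
- have : k.+1%:R + 1 <= j.+1%:R :> R by rewrite natr1 ler_nat.
  lra.
Qed.

Lemma freq_sep (L : R) (j k : nat) : 0 <= L -> j != k ->
  L <= `|j.+1%:R * L - k.+1%:R * L|.
Proof.
by move=> L0 jk; rewrite -mulrBl normrM (ger0_norm L0) ler_peMl // natr_sep.
Qed.

Definition max_freq S : R := \sum_(a <- S) `|a.2|.

Lemma max_freqP S b : b \in S -> `|b.2| <= max_freq S.
Proof.
move=> bS; rewrite /max_freq (big_rem b) //= lerDl.
by apply: sumr_ge0.
Qed.

Lemma max_freq_ge0 S : 0 <= max_freq S.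
Proof. exact: sumr_ge0. Qed.

Lemma cmod_rs_coef a j : (j < 2 ^ a)%N ->
  cmod (Complex (rs_scale a * nth 0 (rs a) j) 0 : R[i]) = rs_scale a.
Proof.
move=> ja; rewrite cmod_real normrM rs_unit // mulr1 ger0_norm //.
exact: ltW (rs_scale_gt0 a).
Qed.

Lemma trig_rs_iota a L y : trig (rs_trig a L) y =
  \sum_(k <- iota 0 (2 ^ a)) Complex (rs_scale a * nth 0 (rs a) k) 0 *
    expi (k.+1%:R * L * y) :> R[i].
Proof. by rewrite /trig big_map. Qed.

Lemma lt_powR_inv (X Y q : R) : 0 < q -> 0 <= Y -> Y `^ q < X -> Y < X `^ q^-1.
Proof.
move=> q0 Y0 YX.
have -> : Y = (Y `^ q) `^ q^-1 by rewrite -powRrM mulfV ?gt_eqF // powRr1.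
by apply: gt0_ltr_powR; rewrite ?invr_gt0 ?nnegrE ?powR_ge0 // (le_trans (powR_ge0 _ _) (ltW YX)).
Qed.

Lemma complex_realM (a b : R) : Complex (a * b) 0 = Complex a 0 * Complex b 0 :> R[i].
Proof. by apply/eqP; rewrite eq_complex /= !(mul0r, mulr0) subr0 addr0 !eqxx. Qed.

Lemma sum_iota_const (N : nat) (w : R) : \sum_(k <- iota 0 N) w = N%:R * w.
Proof. by rewrite big_const_seq count_predT size_iota iter_addr_0 mulr_natl. Qed.

Lemma l1norm_cat S1 S2 : l1norm (S1 ++ S2) = l1norm S1 + l1norm S2.
Proof. by rewrite /l1norm big_cat. Qed.

(** The spacing and the tolerance each limit their share of the error to [c / 4]; [M + 1] avoids
    dividing by 0 when [M = 0]. *)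
Lemma perturbation_le (M c l L del : R) : 0 <= M -> 0 <= l -> 0 < c -> 0 < L ->
  8 * M * l / c <= L -> del = c / (4 * (M + 1)) -> M * (l / (L / 2) + del) <= c / 2.
Proof.
move=> M0 l0 c0 L0 lL ->; rewrite mulrDr.
have h1 : M * (l / (L / 2)) <= c / 4.
  have -> : M * (l / (L / 2)) = (2 * M * l) / L by field; rewrite gt_eqF.
  by rewrite ler_pdivrMr //; move: lL; rewrite ler_pdivrMr //; lra.
have h2 : M * (c / (4 * (M + 1))) <= c / 4.
  have -> : M * (c / (4 * (M + 1))) = (c / 4) * (M / (M + 1)) by field; lra.
  by rewrite ler_piMr ?divr_ge0 ?(ltW c0) // ler_pdivrMr; lra.
lra.
Qed.

(** The test function is the window itself. Its product with [u] has [N] disjoint peaks of height at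
    least [kap * s * c / 2], and the sum of their q-th powers grows geometrically in [a]. *)
Lemma defeating_step_lt2 gamma (p q : R) : schwartz gamma -> (exists t, gamma t != 0) ->
  1 < p -> 1 < q -> q < 2 -> forall S (kap A : R), 0 < kap -> 0 <= A ->
  exists Q (del : R), [/\ 0 < del, forall y, cmod (trig Q y) <= 1 &
    forall E, ccontinuous E -> (forall y, cmod (E y) <= del) ->
    defeats gamma p q A (fun y => trig S y + Complex kap 0 * trig Q y + E y)].
Proof.
move=> sg g0 p1 q1 q2 S kap A kap0 A0; have q0 : 0 < q by lra.
have [c [r [M [[c0 r0 M0] peak]]]] := stft_peak sg g0.
have [K K0 low] := modnorm_lower gamma p1 q1 r0.
have [Bg HB] := modnorm_window_lty sg p1 q1.
have kc0 : 0 < kap * c / 2 by rewrite divr_gt0 // mulr_gt0.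
pose Z := (`|A * Bg| + 1) `^ q.
(* By [rs_scale_powR] with exponent 1, the q-th power of the lower bound equals [T * b ^+ a], and
   [b > 1] because [q < 2]; it has to exceed [Z]. *)
pose b : R := 2 `^ (1 - q / 2).
have b1 : 1 < b.
  have := @gt0_ltr_powR R (1 - q / 2) _ 1 2; rewrite powR1; apply; rewrite ?nnegrE //; lra.
pose T := K * (kap * c / 2) `^ q * 2 `^ (- (q / 2)).
have T0 : 0 < T by rewrite !mulr_gt0 // powR_gt0.
have [a Ha] := expr_unbounded (Z / T) b1.
pose s : R := rs_scale a; have s0 : 0 < s := rs_scale_gt0 a.
pose N := (2 ^ a)%N; have NE : N%:R = 2 ^+ a :> R by rewrite natrX.
have big : Z < K * (kap * s * c / 2) `^ q * N%:R.
  have -> : kap * s * c / 2 = (kap * c / 2) * s by ring.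
  rewrite powRM ?(ltW s0) ?(ltW kc0) // NE.
  have := rs_scale_powR a q 1; rewrite powRr1 ?exprn_ge0 // -/b -/s => E1.
  rewrite mulrA -mulrA E1 mulrA -/T mulrC -ltr_pdivrMr //.
(* Bounds the coefficients of all interfering terms whichever peak is singled out. It is independent
   of the spacing, which is defined from it. *)
pose l := l1norm S + N%:R * (kap * s).
have l0 : 0 <= l by rewrite addr_ge0 ?l1norm_ge0 // mulr_ge0 // mulr_ge0 ?ltW.
have kcs0 : 0 < kap * s * c by rewrite !mulr_gt0.
have F0 := max_freq_ge0 S.
(* The first summands make the frequency boxes disjoint and keep every other frequency at distance
   at least [L / 2] from a box; the last one makes [l / (L / 2)] small. *)
pose L := 2 * (r + max_freq S) + 2 * r + 1 + 8 * M * l / (kap * s * c).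
have L1 : 0 <= 8 * M * l / (kap * s * c) by rewrite divr_ge0 ?(ltW kcs0) // !mulr_ge0.
have L0 : 0 < L by rewrite /L; lra.
have LF : 2 * (r + max_freq S) + 2 * r + 1 <= L by rewrite /L; lra.
have lL : 8 * M * l / (kap * s * c) <= L by rewrite /L; lra.
clearbody L.
pose del := kap * s * c / (4 * (M + 1)).
have M1 : 0 < 4 * (M + 1) by lra.
exists (rs_trig a L), del; split; first by rewrite divr_gt0.
  by move=> y; exact: rs_trig_bounded.
move=> E cE Ed; exists gamma => // H.
set u := (fun y : R => _) in H.
pose coef k : R[i] := Complex (kap * (s * nth 0 (rs a) k)) 0.
have coefE k : (k < N)%N -> cmod (coef k) = kap * s.
  by move=> kN; rewrite /coef complex_realM cmodM (cmod_rs_coef kN) cmod_real gtr0_norm.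
have Hlow : (((K * (kap * s * c / 2) `^ q * N%:R) `^ q^-1)%:E <=
    modnorm gamma p q (mult u gamma))%E.
  apply: (low _ N (fun j => j.+1%:R * L)).
  - by rewrite divr_ge0 // ltW.
  - move=> j k _ _ jk; apply: lt_le_trans (freq_sep (ltW L0) jk); lra.
  move=> x xi j jN xr xi0 xir.
  (* All that interferes with the [j]-th peak: the earlier sum and the other frequencies of the same
     hump. *)
  pose rest := S ++ [seq (coef k, k.+1%:R * L) | k <- iota 0 N & k != j].
  have jI : j \in iota 0 N by rewrite mem_iota.
  have uE : u = (fun y => coef j * expi (j.+1%:R * L * y) + trig rest y + E y).
    apply/funext => y; rewrite /u /rest trig_cat trig_rs_iota mulr_sumr.
    rewrite (bigD1_seq j) ?iota_uniq //= /trig big_map big_filter addrCA -!addrA.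
    congr (_ + (_ + (_ + _))); first by rewrite mulrA -complex_realM.
    by apply: eq_bigr => k _; rewrite mulrA -complex_realM.
  have l1 : l1norm rest <= l.
    rewrite l1norm_cat lerD2l /l1norm big_map big_filter /=.
    apply: (@le_trans _ _ (\sum_(k <- iota 0 N) cmod (coef k))).
      by rewrite [leRHS](bigD1_seq j) ?iota_uniq //= lerDr cmod_ge0.
    rewrite -sum_iota_const big_seq [leRHS]big_seq ler_sum // => k.
    by rewrite mem_iota => kN; rewrite coefE.
  have jL : L <= j.+1%:R * L by rewrite ler_peMl ?ler1n // ltW.
  have sepD b' : b' \in rest -> L / 2 <= `|coord xi 0 - b'.2|.
    rewrite mem_cat => /orP[/max_freqP bS|/mapP [k]].
      have := ler_norm (coord xi 0 - b'.2); move: xi0 bS; rewrite !ler_norml.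
      lra.
    rewrite mem_filter eq_sym => /andP[jk _] ->.
    have := ler_distD (coord xi 0) (j.+1%:R * L) (k.+1%:R * L).
    have := freq_sep (ltW L0) jk; rewrite (distrC _ (coord xi 0)) /=.
    by move: xi0; lra.
  have L2 : 0 < L / 2 by rewrite divr_gt0.
  have := peak (coef j) _ rest E del (L / 2) u x xi cE Ed L2 uE xr xi0 xir sepD.
  rewrite coefE //.
  have := perturbation_le M0 l0 kcs0 L0 lL erefl; rewrite -/del.
  have : M * (l1norm rest / (L / 2) + del) <= M * (l / (L / 2) + del).
    by rewrite ler_wpM2l // lerD2r ler_wpM2r // invr_ge0 ltW.
  lra.
have AB : (A%:E * modnorm gamma p q gamma <= (A * Bg)%:E)%E.
  by rewrite EFinM lee_wpmul2l // lee_fin.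
have := le_trans Hlow (le_trans H AB); rewrite lee_fin leNgt => /negP; apply.
apply: (le_lt_trans _ (lt_powR_inv q0 _ big)).
  by rewrite (le_trans (ler_norm _)) // lerDl.
by rewrite addr_ge0.
Qed.

End FrequencySpread.

(** * The hump for q > 2 *)

Section FrequencyConcentration.
Context {R : realType} {m : nat}.
Local Notation rV := 'rV[R]_m.+1.
Let mu := @lebesgue_measure R.
Implicit Types (gamma f : rV -> R[i]) (E : R -> R[i]) (x xi : rV)
  (S : seq (R[i] * R)).

(* Terms below the fraction 1 / (2 N) of the sum make up at most half of it. *)
Lemma power_sum_le (N : nat) (a : nat -> R) (s : R) : (0 < N)%N -> 1 < s ->
  (forall k, 0 <= a k) ->
  (\sum_(k < N) a k) `^ s <= 2 * (2 * N%:R) `^ (s - 1) * \sum_(k < N) (a k `^ s).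
Proof.
move=> N0 s1 a0; set T := \sum_(k < N) a k.
have T0 : 0 <= T by apply: sumr_ge0.
have Nr : 0 < N%:R :> R by rewrite ltr0n.
have N2 : 0 < 2 * N%:R :> R by rewrite mulr_gt0.
have s0 : 0 < s by lra. have s10 : 0 <= s - 1 by lra.
have TE : T `^ s = T * T `^ (s - 1) by rewrite mulr_powRB1.
have each k : a k * T `^ (s - 1) <= (2 * N%:R) `^ (s - 1) * a k `^ s + T `^ s / (2 * N%:R).
  case: (lerP T (2 * N%:R * a k)) => H.
    rewrite -[leLHS]addr0 lerD ?divr_ge0 ?powR_ge0 ?(ltW N2) //.
    rewrite -(mulr_powRB1 (a0 k) s0) mulrCA ler_wpM2l // -powRM ?(ltW N2) //.
    by apply: ge0_ler_powR; rewrite ?nnegrE ?mulr_ge0 ?(ltW N2).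
  rewrite -[leLHS]add0r lerD ?mulr_ge0 ?powR_ge0 //.
  rewrite TE -mulrA mulrCA mulrC ler_wpM2l ?powR_ge0 //.
  by rewrite ler_pdivlMr // mulrC ltW.
have : T `^ s <= (2 * N%:R) `^ (s - 1) * (\sum_(k < N) (a k `^ s)) + T `^ s / 2.
  rewrite {1}TE {1}/T mulr_suml.
  apply: (@le_trans _ _ (\sum_(k < N)
      ((2 * N%:R) `^ (s - 1) * a k `^ s + T `^ s / (2 * N%:R)))).
    by apply: ler_sum => k _; exact: each.
  rewrite big_split /= -mulr_sumr lerD2l sumr_const card_ord -[leLHS]mulr_natr.
  by rewrite le_eqVlt; apply/orP; left; apply/eqP; field; rewrite gt_eqF.
lra.
Qed.

(** At most one [lam k] is closer to [y] than [L / 2] and contributes at most 1; the others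
    contribute at most [2 / L] each, hence at most 2 together because [N <= L]. *)
Lemma sum_decay_separated (N : nat) (lam : nat -> R) (L y : R) : 0 < L -> N%:R <= L ->
  (forall j k, j != k -> L <= `|lam j - lam k|) ->
  \sum_(k < N) decay 1 (y - lam k) <= 3.
Proof.
move=> L0 NL sep.
have far k : L / 2 <= `|y - lam k| -> decay 1 (y - lam k) <= 2 / L.
  by move=> /(decay1_le (divr_gt0 L0 _)); rewrite invf_div; apply.
have N2 : N%:R * (2 / L) <= 2.
  by rewrite mulrCA ler_piMr // ler_pdivrMr // mul1r.
have [/existsP [j Hj]|/existsPn Hn] :=
    boolP [exists j : 'I_N, `|y - lam j| < L / 2].
  rewrite (bigD1 j) //=.
  have h1 : decay 1 (y - lam j) <= 1 by exact: decay_le1.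
  have h2 : \sum_(k < N | k != j) decay 1 (y - lam k) <= N%:R * (2 / L).
    rewrite -[N in N%:R]card_ord mulr_natl -sumr_const.
    rewrite [leRHS](bigID (fun k => k != j)) /= -[leLHS]addr0 lerD //; last first.
      by apply: sumr_ge0 => k _; rewrite divr_ge0 // ltW.
    apply: ler_sum => k kj; apply: far.
    have := sep k j kj; have := ler_distD y (lam k) (lam j).
    by rewrite (distrC (lam k) y); lra.
  lra.
have : \sum_(k < N) decay 1 (y - lam k) <= N%:R * (2 / L).
  rewrite -[N in N%:R]card_ord mulr_natl -sumr_const.
  by apply: ler_sum => k _; apply: far; rewrite leNgt; exact: Hn.
lra.
Qed.

Lemma integral_sum_decay_powR (N : nat) (lam : nat -> R) (s I : R) :
  (\int[mu]_y (decay 1 y `^ s)%:E)%E = I%:E ->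
  (\int[mu]_y (\sum_(k < N) decay 1 (y - lam k) `^ s)%:E)%E = (N%:R * I)%:E.
Proof.
move=> HI; under eq_integral do rewrite -sumEFin.
rewrite ge0_integral_sum //.
- rewrite (eq_bigr (fun=> I%:E)) => [|k _].
    by rewrite sumEFin; congr EFin; rewrite sumr_const card_ord -[LHS]mulr_natl.
  rewrite (@integral_shift_ge0 R (fun y => decay 1 y `^ s) (- lam k)) //.
    move=> y; apply: (@continuous_comp _ _ _ (decay 1) (@powR R ^~ s)).
      exact: decay_continuous.
    apply: differentiable_continuous; apply/derivable1_diffP.
    by apply: derivable_powR; rewrite in_itv /= andbT decay_gt0.
  by move=> y; exact: powR_ge0.
- by move=> k; apply/measurable_EFinP; exact: decay_powR_measurable.
- by move=> k y _; rewrite lee_fin powR_ge0.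
Qed.

Lemma rs_freq_sep (L : R) (j k : nat) : 0 <= L -> j != k ->
  L <= `|j.+1%:R * - L - k.+1%:R * - L|.
Proof.
by move=> L0 jk; rewrite !mulrN opprK addrC distrC freq_sep.
Qed.

(** The tails [decay 1] overlap and are not integrable, so the q-th power of their sum [G] is split:
    [G ^ (q - s)] is bounded by [3 ^ (q - s)], and [G ^ s] by [power_sum_le]. This gives [N ^ s] in
    place of the ideal [N], a loss that is affordable when [s < q / 2]. *)
Lemma modnorm_rs_upper gamma (p q s : R) : schwartz gamma -> 1 < p -> 1 < s -> s < q ->
  exists2 K : R, 0 <= K & forall (a : nat) (L : R), 2 ^+ a <= L ->
  (modnorm gamma p q (mult (trig (rs_trig a (- L))) gamma) <=
    ((K * (rs_scale a `^ q * (2 ^+ a) `^ s)) `^ q^-1)%:E)%E.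
Proof.
move=> sg p1 s1 sq; have q1 : 1 < q by lra.
have q0 : 0 < q by lra. have s0 : 0 < s by lra.
have [K K0 up] := modnorm_upper gamma p1 q1 (m := m).
have [M M0 [up1 _]] := stft_bounds sg.
have [Iq Iq0 IqE] := integral_decay_powR q1.
have [Is Is0 IsE] := integral_decay_powR s1.
exists (K * (M `^ q * 3 `^ (q - s) * (2 * 2 `^ (s - 1)) * Is * Iq ^+ m)).
  by rewrite !mulr_ge0 ?powR_ge0 ?exprn_ge0.
move=> a L aL.
pose N := (2 ^ a)%N; have NE : N%:R = 2 ^+ a :> R by rewrite natrX.
have N0 : (0 < N)%N by rewrite expn_gt0.
have Nr : 0 < N%:R :> R by rewrite ltr0n.
have L0 : 0 < L by apply: lt_le_trans aL; rewrite exprn_gt0.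
pose lam (k : nat) : R := k.+1%:R * - L.
pose G y := \sum_(k < N) decay 1 (y - lam k).
have G0 y : 0 <= G y by apply: sumr_ge0 => k _; exact: decay_ge0.
have G3 y : G y <= 3.
  apply: (sum_decay_separated _ L0); first by rewrite NE.
  by move=> j k; exact: rs_freq_sep (ltW L0).
pose B xi := M * rs_scale a * G (coord xi 0) * \prod_(i < m) decay 1 (coord xi i.+1).
have ra0 := rs_scale_gt0 a (R := R).
have P0 xi : 0 <= \prod_(i < m) decay 1 (coord xi i.+1).
  by apply: prodr_ge0 => i _; exact: decay_ge0.
have Gq y : G y `^ q <=
    3 `^ (q - s) * (2 * (2 * N%:R) `^ (s - 1)) * \sum_(k < N) decay 1 (y - lam k) `^ s.
  have -> : q = (q - s) + s by ring.
  rewrite powRD; last by rewrite subrK gt_eqF.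
  rewrite addrK -mulrA; apply: ler_pM; rewrite ?powR_ge0 //.
    by apply: ge0_ler_powR; rewrite ?nnegrE ?G0 ?G3 //; lra.
  apply: (@power_sum_le N (fun k => decay 1 (y - lam k)) s) => // k.
  exact: decay_ge0.
pose g (i : nat) : R -> R := if i is 0
  then (fun y => \sum_(k < N) decay 1 (y - lam k) `^ s) else (fun y => decay 1 y `^ q).
pose I (i : nat) : R := if i is 0 then N%:R * Is else Iq.
have := up (mult (trig (rs_trig a (- L))) gamma) B
  ((M * rs_scale a) `^ q * (3 `^ (q - s) * (2 * (2 * N%:R) `^ (s - 1)))) g I.
have -> : K * ((M * rs_scale a) `^ q * (3 `^ (q - s) * (2 * (2 * N%:R) `^ (s - 1)))) *
    \prod_(i < m.+1) I i =
  K * (M `^ q * 3 `^ (q - s) * (2 * 2 `^ (s - 1)) * Is * Iq ^+ m) *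
    (rs_scale a `^ q * (2 ^+ a) `^ s).
  rewrite big_ord_recl /= prodr_const card_ord (powRM _ M0 (ltW ra0)).
  rewrite (powRM (s - 1) _ (ltW Nr)) // -NE -(mulr_powRB1 (ltW Nr) s0).
  by ring.
apply.
- move=> x xi; rewrite (stft_multE x xi sg (trig_continuous _) (trig_bounded _)).
  rewrite (stft_mult_trig _ x xi sg) (le_trans (cmod_sum _ _)) // big_map.
  rewrite (_ : B xi * _ = \sum_(k <- iota 0 (2 ^ a)) rs_scale a *
     (M * stft_weight x xi * decay 1 (coord xi 0 - lam k))); last first.
    rewrite -mulr_sumr -mulr_sumr -[X in iota _ X]subn0 big_mkord -/(G _).
    by rewrite /B /stft_weight; ring.
  rewrite big_seq [leRHS]big_seq ler_sum // => k; rewrite mem_iota /= => kN.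
  by rewrite cmodM cmod_rs_coef // ler_wpM2l ?(ltW ra0).
- by move=> xi; rewrite !mulr_ge0 // ltW.
- move=> [|i] /=; last first.
    have := decay_powR_measurable q 0.
    by congr measurable_fun; apply/funext => y; rewrite addr0.
  by apply: measurable_sum => k; exact: decay_powR_measurable.
- by move=> [|i] y; rewrite ?powR_ge0 //; apply: sumr_ge0 => k _; exact: powR_ge0.
- by move=> [|i] //=; exact: integral_sum_decay_powR.
- by rewrite !mulr_ge0 ?powR_ge0.
- move=> xi; rewrite /B big_ord_recl /=.
  rewrite powRM ?mulr_ge0 ?(ltW ra0) // powRM ?mulr_ge0 ?(ltW ra0) //.
  rewrite mulrA; apply: ler_pM; rewrite ?mulr_ge0 ?powR_ge0 //.
    by rewrite -[leRHS]mulrA ler_wpM2l ?powR_ge0 //; exact: Gq.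
  rewrite le_eqVlt; apply/orP; left; apply/eqP.
  elim: (index_enum _) => [|i l IH]; first by rewrite !big_nil powR1.
  rewrite !big_cons powRM ?decay_ge0 ?IH //.
  by apply: prodr_ge0 => j _; exact: decay_ge0.
Qed.

Lemma rs_coef_sqr a j : (j < 2 ^ a)%N ->
  (rs_scale a * nth 0 (rs a) j) * (rs_scale a * nth 0 (rs a) j) = rs_scale a ^+ 2 :> R.
Proof.
move=> ja; rewrite -expr2 exprMn -[nth 0 _ _ ^+ 2]real_normK ?num_real //.
by rewrite rs_unit // expr1n mulr1.
Qed.

(** The test function is the conjugate polynomial times the window. Its norm decays geometrically in
    [a], while multiplication by [u] produces a peak at frequency 0 of height independent of [a]. *)
Lemma defeating_step_gt2 gamma (p q : R) : schwartz gamma -> (exists t, gamma t != 0) ->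
  1 < p -> 2 < q -> forall S (kap A : R), 0 < kap -> 0 <= A ->
  exists Q (del : R), [/\ 0 < del, forall y, cmod (trig Q y) <= 1 &
    forall E, ccontinuous E -> (forall y, cmod (E y) <= del) ->
    defeats gamma p q A (fun y => trig S y + Complex kap 0 * trig Q y + E y)].
Proof.
move=> sg g0 p1 q2 S kap A kap0 A0; have q0 : 0 < q by lra. have q1 : 1 < q by lra.
have [c [r [M [[c0 r0 M0] peak]]]] := stft_peak sg g0.
have [K K0 low] := modnorm_lower gamma p1 q1 r0.
(* The midpoint of 1 and [q / 2]: above 1 for integrability, and below [q / 2] so that [b] below is
   less than 1. *)
pose sg' := (1 + q / 2) / 2.
have sg1 : 1 < sg' by rewrite /sg'; lra.
have sg2 : sg' < q / 2 by rewrite /sg'; lra.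
have sg3 : sg' < q by lra.
have [Ku Ku0 up] := modnorm_rs_upper sg p1 sg1 sg3.
have kc0 : 0 < kap * c / 4 by rewrite divr_gt0 // mulr_gt0.
(* The peak at frequency 0 has coefficient [kap / 2], hence height at least [c * kap / 2]; the
   spacing and the tolerance will limit the errors to half of that. *)
pose X := K * (kap * c / 4) `^ q.
have X0 : 0 < X by rewrite mulr_gt0 // powR_gt0.
pose b : R := 2 `^ (sg' - q / 2).
have b0 : 0 < b by rewrite powR_gt0.
have b1 : 1 < b^-1.
  rewrite /b -powRN opprB.
  have := @gt0_ltr_powR R (q / 2 - sg') _ 1 2; rewrite powR1; apply; rewrite ?nnegrE //; lra.
pose T := (A `^ q * Ku + 1) * 2 `^ (- (q / 2)).
have AK0 : 0 <= A `^ q * Ku by rewrite mulr_ge0 ?powR_ge0.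
have [a Ha] := expr_unbounded (T / X) b1.
pose s : R := rs_scale a; have s0 : 0 < s := rs_scale_gt0 a.
pose N := (2 ^ a)%N; have NE : N%:R = 2 ^+ a :> R by rewrite natrX.
pose ya := s `^ q * (2 ^+ a) `^ sg'.
have ya0 : 0 <= ya by rewrite mulr_ge0 ?powR_ge0.
have small : A `^ q * (Ku * ya) < X.
  apply: (@le_lt_trans _ _ ((A `^ q * Ku + 1) * ya)); first by rewrite mulrA ler_wpM2r //; lra.
  rewrite /ya rs_scale_powR -/b mulrA -/T.
  by rewrite -ltr_pdivlMr ?exprn_gt0 // mulrC -exprVn -ltr_pdivrMr.
(* The first summand bounds the products of [S] with the conjugate polynomial, the second the
   off-diagonal products inside the hump. *)
pose l := l1norm S * (N%:R * s) + N%:R * (N%:R * (kap * s ^+ 2)).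
have l0 : 0 <= l.
  rewrite addr_ge0 //; first by rewrite mulr_ge0 ?l1norm_ge0 // mulr_ge0 // ltW.
  by rewrite !mulr_ge0 ?sqr_ge0 // ltW.
have kc2 : 0 < kap * c / 2 by rewrite divr_gt0 // mulr_gt0.
have F0 := max_freq_ge0 S.
(* Besides separating the frequencies, [L] must dominate [2 ^+ a] for [modnorm_rs_upper] to
   apply. *)
pose L := 2 * (r + max_freq S) + 2 * r + 1 + 2 ^+ a + 8 * M * l / (kap * c / 2).
have L1 : 0 <= 8 * M * l / (kap * c / 2) by rewrite divr_ge0 ?(ltW kc2) // !mulr_ge0.
have a2 : 0 < 2 ^+ a :> R by rewrite exprn_gt0.
have L0 : 0 < L by rewrite /L; lra.
have LF : 2 * (r + max_freq S) + 2 * r + 1 <= L by rewrite /L; lra.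
have La : 2 ^+ a <= L by rewrite /L; lra.
have lL : 8 * M * l / (kap * c / 2) <= L by rewrite /L; lra.
clearbody L.
pose del := (kap * c / 2) / (4 * (M + 1)).
have M1 : 0 < 4 * (M + 1) by lra.
exists (rs_trig a L), del; split; first by rewrite divr_gt0.
  by move=> y; exact: rs_trig_bounded.
move=> E cE Ed.
(* The coefficients are real, so changing the sign of the frequencies is complex conjugation. *)
pose Qm := trig (rs_trig a (- L)).
exists (mult Qm gamma); first exact: schwartz_mult_trig.
set u := (fun y : R => _) => H.
pose w k : R := s * nth 0 (rs a) k.
have wE k : (k < N)%N -> cmod (Complex (w k) 0 : R[i]) = s by exact: cmod_rs_coef.
pose u' y := u y * Qm y.
have uu : mult u (mult Qm gamma) = mult u' gamma.
  by apply/funext => t; rewrite /mult /u' mulrA.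
pose R1 : seq (R[i] * R) :=
  [seq (b'.1 * Complex (w k) 0, b'.2 + k.+1%:R * - L) | b' <- S, k <- iota 0 N].
pose R2 := [seq (Complex (kap * (w j * w k)) 0 : R[i], j.+1%:R * L + k.+1%:R * - L) |
  j <- iota 0 N, k <- [seq k <- iota 0 N | k != j]].
have trig1 y : trig R1 y = trig S y * Qm y.
  rewrite /trig big_allpairs_dep mulr_suml; apply: eq_bigr => b' _.
  rewrite -/(trig _ _) /Qm trig_rs_iota mulr_sumr; apply: eq_bigr => k _ /=.
  by rewrite mulrDl expiD; ring.
(* The diagonal terms have frequency 0 and add up to [kap * N * s ^+ 2 = kap / 2]; the off-diagonal
   frequencies are nonzero multiples of [L]. *)
have trig2 y : Complex kap 0 * trig (rs_trig a L) y * Qm y =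
    Complex (kap / 2) 0 + trig R2 y.
  rewrite /Qm !trig_rs_iota -mulrA mulr_suml mulr_sumr.
  have -> : Complex (kap / 2) 0 = \sum_(j <- iota 0 N) Complex (kap * s ^+ 2) 0 :> R[i].
    rewrite big_const_seq count_predT size_iota iter_addr_0.
    have -> : kap / 2 = N%:R * (kap * s ^+ 2).
      by rewrite NE -(rs_scale_sqr a); rewrite /s; ring.
    elim: (N) => [|k IH]; first by rewrite mul0r mulr0n.
    rewrite mulrSr -IH -natr1; apply/eqP; rewrite eq_complex /= addr0 eqxx andbT.
    by apply/eqP; ring.
  rewrite /trig /R2 big_allpairs_dep -big_split /= big_seq [RHS]big_seq.
  apply: eq_bigr => j; rewrite mem_iota /= add0n => jN.
  rewrite !mulr_sumr (bigD1_seq j) ?iota_uniq ?mem_iota //=; congr (_ + _).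
    rewrite mulrACA -expiD mulrA -!complex_realM rs_coef_sqr // -/s.
    by rewrite (_ : _ + _ = 0) ?expi0 ?mulr1 //; ring.
  rewrite big_filter; apply: eq_bigr => k _.
  by rewrite mulrDl expiD !complex_realM; ring.
pose rest := R1 ++ R2.
have uE : u' = (fun y => Complex (kap / 2) 0 * expi (0 * y) + trig rest y + E y * Qm y).
  apply/funext => y; rewrite /u' /u /rest trig_cat trig1 2!mulrDl trig2 mul0r expi0 mulr1.
  by rewrite -!addrA addrCA.
have cQ : ccontinuous (fun y => E y * Qm y) by apply: ccontinuousM (trig_continuous _).
have bQ y : cmod (E y * Qm y) <= del.
  rewrite cmodM -[leRHS]mulr1; apply: ler_pM; rewrite ?cmod_ge0 //.
  exact: rs_trig_bounded.
have l1 : l1norm rest <= l.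
  rewrite l1norm_cat lerD //.
    rewrite /l1norm big_allpairs_dep mulr_suml ler_sum // => b' _.
    rewrite (eq_big_seq (fun=> cmod b'.1 * s)) => [|k]; last first.
      by rewrite mem_iota /= => kN; rewrite cmodM wE.
    by rewrite [leLHS]sum_iota_const mulrCA.
  rewrite /l1norm big_allpairs_dep -sum_iota_const big_seq [leRHS]big_seq ler_sum // => j.
  rewrite mem_iota /= => jN; rewrite -sum_iota_const big_filter big_seq_cond /=.
  rewrite [leRHS](bigID (fun k => (k \in iota 0 N) && (k != j))) /= -[leLHS]addr0 lerD //.
    apply: ler_sum => k /andP[]; rewrite mem_iota /= => kN _.
    rewrite complex_realM cmodM complex_realM cmodM !wE // cmod_real gtr0_norm //.
  by apply: sumr_ge0 => k _; rewrite mulr_ge0 ?sqr_ge0 // ltW.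
have Hlow : ((X `^ q^-1)%:E <= modnorm gamma p q (mult u (mult Qm gamma)))%E.
  have -> : X = K * (kap * c / 4) `^ q * 1%:R by rewrite mulr1.
  (* A single peak, at frequency 0, already suffices here. *)
  rewrite uu; apply: (low _ 1%N (fun=> 0)).
  - exact: ltW.
  - by move=> [|j] [|k].
  move=> x xi j _ xr xi0 xir.
  have sepD b' : b' \in rest -> L / 2 <= `|coord xi 0 - b'.2|.
    rewrite mem_cat => /orP[/allpairsP [[b'' k] /= [/max_freqP bS _ ->]]|].
      have kL : L <= k.+1%:R * L by rewrite ler_peMl ?ler1n // ltW.
      have := ler_norm (coord xi 0 - (b''.2 + k.+1%:R * - L)).
      by move: xi0 bS; rewrite subr0 !ler_norml mulrN /=; lra.
    move=> /allpairsPdep [j' [k [_]]]; rewrite mem_filter => /andP[jk _] -> /=.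
    have := ler_distD (coord xi 0) 0 (j'.+1%:R * L - k.+1%:R * L).
    have := freq_sep (ltW L0) jk; rewrite sub0r sub0r !normrN mulrN => h1 h2.
    by rewrite distrC in h1; rewrite subr0 in xi0; lra.
  have L2 : 0 < L / 2 by rewrite divr_gt0.
  have := peak (Complex (kap / 2) 0) 0 rest _ del (L / 2) u' x xi cQ bQ L2 uE xr xi0 xir sepD.
  rewrite cmod_real ger0_norm ?divr_ge0 ?(ltW kap0) //.
  have := perturbation_le M0 l0 kc2 L0 lL erefl; rewrite -/del.
  have : M * (l1norm rest / (L / 2) + del) <= M * (l / (L / 2) + del).
    by rewrite ler_wpM2l // lerD2r ler_wpM2r // invr_ge0 ltW.
  lra.
have AB : (A%:E * modnorm gamma p q (mult Qm gamma) <= (A * (Ku * ya) `^ q^-1)%:E)%E.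
  by rewrite EFinM; apply: lee_wpmul2l; [rewrite lee_fin|exact: up].
have := le_trans Hlow (le_trans H AB); rewrite lee_fin leNgt => /negP; apply.
have Ky0 : 0 <= Ku * ya by rewrite mulr_ge0.
rewrite -powR_mul_invr //; apply: gt0_ltr_powR; rewrite ?invr_gt0 ?nnegrE ?(ltW X0) //.
by rewrite mulr_ge0 ?powR_ge0.
Qed.

End FrequencyConcentration.

(** * The gliding hump *)

Section GlidingHump.
Context {R : realType}.

(** Halving makes the tail of [kap] from [k] on sum to at most [2 * kap k], so the intervals of that
    radius around [x k] are nested; the limit is the supremum of their left endpoints. *)
Lemma nested_limit (x kap : nat -> R) :
  (forall k, 2 * kap k.+1 <= kap k) -> (forall k, `|x k.+1 - x k| <= kap k) ->
  exists l, forall k, `|l - x k| <= 2 * kap k.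
Proof.
move=> kk xk; pose a k := x k - 2 * kap k; pose b k := x k + 2 * kap k.
have k0 k : 0 <= kap k := le_trans (normr_ge0 _) (xk k).
have aS k : a k <= a k.+1.
  by have := xk k; have := kk k; rewrite ler_norml /a; lra.
have bS k : b k.+1 <= b k.
  by have := xk k; have := kk k; rewrite ler_norml /b; lra.
have am : {homo a : i j / (i <= j)%N >-> i <= j} by apply: homo_leq => // ? ? ?; exact: le_trans.
have bm i j : (i <= j)%N -> b j <= b i.
  elim: j => [|j IH]; first by rewrite leqn0 => /eqP ->.
  rewrite leq_eqVlt => /orP[/eqP -> //|]; rewrite ltnS => /IH; exact: le_trans.
have ab i j : a i <= b j.
  apply: (@le_trans _ _ (a (maxn i j))); first by apply: am; exact: leq_maxl.
  apply: (@le_trans _ _ (b (maxn i j))); last by apply: bm; exact: leq_maxr.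
  by have := k0 (maxn i j); rewrite /a /b; lra.
exists (sup (range a)) => k.
have h1 : a k <= sup (range a).
  apply: ub_le_sup; last by exists k.
  by exists (b 0%N) => _ [i _ <-].
have h2 : sup (range a) <= b k.
  by apply: ge_sup; [exists (a 0%N); exists 0%N|move=> _ [i _ <-]].
by rewrite ler_norml; move: h1 h2; rewrite /a /b; lra.
Qed.

Lemma uniform_approx_continuous (f : R -> R) :
  (forall e : R, 0 < e -> exists2 g : R -> R, continuous g & forall y, `|f y - g y| <= e) ->
  continuous f.
Proof.
move=> H y; apply/cvgrPdist_le => e e0.
have e3 : 0 < e / 3 by rewrite divr_gt0.
have [g cg fg] := H _ e3.
have /cvgrPdist_le/(_ _ e3) := cg y; apply: filterS => z gz.
have h1 := fg y; have h2 := fg z.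
have -> : f y - f z = (f y - g y) + ((g y - g z) - (f z - g z)) by ring.
rewrite (le_trans (ler_normD _ _)) //.
have := ler_normB (g y - g z) (f z - g z); lra.
Qed.

Lemma gliding_hump (P : nat -> (R -> R[i]) -> Prop) :
  (forall k S (kap : R), 0 < kap -> exists Q (del : R),
    [/\ 0 < del, forall y, cmod (trig Q y) <= 1 &
     forall E, ccontinuous E -> (forall y, cmod (E y) <= del) ->
       P k (fun y => trig S y + Complex kap 0 * trig Q y + E y)]) ->
  exists u, [/\ ccontinuous u, forall y, cmod (u y) <= 1 & forall k, P k u].
Proof.
move=> step.
(* Positivity of the amplitude is a premise inside the relation, which makes the relation total and
   lets choice produce a function; a nonpositive amplitude gets a dummy value. *)
pose good (t : nat * (seq (R[i] * R) * R)) (Qd : seq (R[i] * R) * R) := 0 < t.2.2 ->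
  [/\ 0 < Qd.2, forall y, cmod (trig Qd.1 y) <= 1 &
     forall E, ccontinuous E -> (forall y, cmod (E y) <= Qd.2) ->
       P t.1 (fun y => trig t.2.1 y + Complex t.2.2 0 * trig Qd.1 y + E y)].
have ex_good t : exists Qd, good t Qd.
  case: t => k [S kap].
  have [kap0|kap0] := ltrP 0 kap; last first.
    by exists ([::], 0); rewrite /good /= ltNge kap0.
  by have [Q [del H]] := step k S kap kap0; exists (Q, del).
have [F HF] := boolp.choice ex_good.
(* The state is the partial sum together with the next amplitude. The remainder will be at most four
   times that amplitude: 2 from the geometric tail and 2 from splitting into real and imaginary
   parts. Hence the quarter of the tolerance, and the initial value 1/4, which yields
   [cmod (u y) <= 1]. *)
pose st := fix st (k : nat) : seq (R[i] * R) * R := match k with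
  | 0 => ([::], 4^-1)
  | k'.+1 => let t := st k' in let Qd := F (k', t) in
      (t.1 ++ [seq (Complex t.2 0 * b.1, b.2) | b <- Qd.1], Num.min (t.2 / 2) (Qd.2 / 4))
  end.
pose kap k := (st k).2; pose s k := trig (st k).1.
have kap0 k : 0 < kap k.
  elim: k => [|k IH]; first by rewrite /kap /= invr_gt0.
  rewrite /kap /= lt_min divr_gt0 //=.
  by have [d0 _ _] := HF (k, st k) IH; rewrite divr_gt0.
have kapS k : 2 * kap k.+1 <= kap k.
  have : kap k.+1 <= kap k / 2 by rewrite /kap /= ge_min lexx.
  by lra.
have sS k y : s k.+1 y = s k y + Complex (kap k) 0 * trig (F (k, st k)).1 y.
  rewrite /s /= trig_cat; congr (_ + _); rewrite /trig big_map mulr_sumr.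
  by apply: eq_bigr => b _ /=; rewrite mulrA.
have dS k y : cmod (s k.+1 y - s k y) <= kap k.
  rewrite sS addrAC subrr add0r cmodM cmod_real gtr0_norm // ler_piMr ?(ltW (kap0 k)) //.
  by have [_ h _] := HF (k, st k) (kap0 k).
have ex_limit y : exists z : R[i], forall k,
    `|complex.Re z - complex.Re (s k y)| <= 2 * kap k /\
    `|complex.Im z - complex.Im (s k y)| <= 2 * kap k.
  have [l1 H1] : exists l, forall k, `|l - complex.Re (s k y)| <= 2 * kap k.
    apply: nested_limit => // k; rewrite -cReN -cReD.
    exact: le_trans (normr_Re_le _) (dS k y).
  have [l2 H2] : exists l, forall k, `|l - complex.Im (s k y)| <= 2 * kap k.
    apply: nested_limit => // k; rewrite -cImN -cImD.
    exact: le_trans (normr_Im_le _) (dS k y).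
  by exists (Complex l1 l2) => k; split; [exact: H1|exact: H2].
have [u Hu] := boolp.choice ex_limit.
have us k y : cmod (u y - s k y) <= 4 * kap k.
  have [h1 h2] := Hu y k; rewrite (le_trans (cmod_le_Re_Im _)) // cReD cReN cImD cImN.
  lra.
have kap_small e : 0 < e -> exists k, 2 * kap k <= e.
  move=> e0; have [k Hk] := @expr_unbounded R 2 e^-1 (ltr1n _ 2).
  exists k; have kap2 j : 2 * kap j * 2 ^+ j <= 1.
    elim: j => [|j IH]; first by rewrite /kap /= expr0; lra.
    rewrite exprS; apply: le_trans IH; rewrite mulrCA mulrA mulrA ler_wpM2r ?exprn_ge0 //.
    by rewrite -mulrA ler_wpM2l.
  have p0 : 0 < 2 ^+ k :> R by rewrite exprn_gt0.
  have := kap2 k; rewrite -ler_pdivlMr // div1r => /le_trans; apply.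
  by rewrite -[leRHS]invrK lef_pV2 ?posrE ?invr_gt0 // ltW.
have cu : ccontinuous u.
  split; apply: uniform_approx_continuous => e /kap_small [k ke].
  - exists (fun y => complex.Re (s k y)) => [|y]; first exact: (trig_continuous _).1.
    exact: le_trans (Hu y k).1 ke.
  - exists (fun y => complex.Im (s k y)) => [|y]; first exact: (trig_continuous _).2.
    exact: le_trans (Hu y k).2 ke.
exists u; split=> // [y|k].
  have := us 0%N y; rewrite /s /= /trig big_nil subr0 /kap /= mulfV //.
have [d0 _ HP] := HF (k, st k) (kap0 k).
(* Everything added after the [k]-th hump is the perturbation that this hump was built to
   tolerate. *)
pose E y := u y + -1 * s k.+1 y.
have := HP E _ _; have -> : (fun y => trig (k, st k).2.1 y +
    Complex (k, st k).2.2 0 * trig (F (k, st k)).1 y + E y) = u.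
  by apply/funext => y; rewrite /E sS /s /kap /=; ring.
apply.
- apply: ccontinuousD => //; apply: ccontinuousM; first exact: ccontinuous_cst.
  exact: trig_continuous.
- move=> y; rewrite /E mulN1r; apply: le_trans (us k.+1 y) _.
  have : kap k.+1 <= (F (k, st k)).2 / 4 by rewrite /kap /= ge_min lexx orbT.
  by lra.
Qed.

End GlidingHump.

(** * Multiplication operators as Calderón-Zygmund operators *)

Section MultiplicationOperator.
Context {R : realType} {m : nat}.
Local Notation rV := 'rV[R]_m.+1.

Lemma continuous_borel (h : rV -> R) : continuous h -> borel_fun h.
Proof.
move=> ch U oU; apply: sub_sigma_algebra => /=.
by move/continuousP: ch; exact.
Qed.

Lemma iterint0 k : iterint k (fun _ : seq R => 0%E) = 0%E.
Proof. by elim: k => [//|k IH] /=; under eq_integral do rewrite IH; rewrite integral0. Qed.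

Lemma cint0 : cint (fun _ : rV => 0 : R[i]) = 0.
Proof.
transitivity (Complex (fine 0%E) (fine 0%E) : R[i]); last by [].
by congr Complex; exact: (congr1 fine (iterint0 m.+1)).
Qed.

Lemma CZ_operator_mult (u : R -> R[i]) : ccontinuous u -> (forall y, cmod (u y) <= 1) ->
  CZ_operator (@mult R m u).
Proof.
move=> [ur ui] u1; split.
- move=> f sf; have [fr fi] := schwartz_continuous sf.
  have c1 : continuous (fun t : rV => complex.Re (u (t 0 0))).
    by move=> t; apply: (@continuous_comp _ _ _ (fun t : rV => t 0 0)
      (fun y => complex.Re (u y))); [exact: coord_continuous|exact: ur].
  have c2 : continuous (fun t : rV => complex.Im (u (t 0 0))).
    by move=> t; apply: (@continuous_comp _ _ _ (fun t : rV => t 0 0)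
      (fun y => complex.Im (u y))); [exact: coord_continuous|exact: ui].
  split; apply: continuous_borel => t; rewrite /mult.
  + under eq_fun do rewrite cReM.
    exact: (continuousB (continuousM (c1 t) (fr t)) (continuousM (c2 t) (fi t))).
  + under eq_fun do rewrite cImM.
    exact: (continuousD (continuousM (c1 t) (fi t)) (continuousM (c2 t) (fr t))).
- by move=> a f g _ _; apply/funext => t; rewrite /mult; ring.
- exists 1 => f _; rewrite expr1n mul1e; apply: iterint_le => [s|s _].
    by rewrite lee_fin sqr_ge0.
  rewrite lee_fin; apply: lerXn2r; rewrite ?nnegrE ?cmod_ge0 //.
  by rewrite cmodM ler_piMl ?cmod_ge0.
- exists (fun _ _ => 0), 1, 1; split.
    split=> [|||x x' y _|x y y' _]; rewrite ?ltr01 ?lexx //.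
    + by move=> x y _; rewrite cmod0 divr_ge0 // exprn_ge0 // sqrtr_ge0.
    + by rewrite subrr cmod0 divr_ge0 ?mulr_ge0 ?powR_ge0.
    + by rewrite subrr cmod0 divr_ge0 ?mulr_ge0 ?powR_ge0.
  (* With disjoint supports [u * f * g] vanishes at every point, so the two integrands agree
     pointwise. *)
  move=> f g _ _ dis; congr cint; apply/funext => x.
  have -> : (fun y : rV => 0 * f y) = (fun=> 0) by apply/funext => y; rewrite mul0r.
  rewrite cint0 mul0r /mult.
  have [->|fx] := eqVneq (f x) 0; first by rewrite mulr0 mul0r.
  have [->|gx] := eqVneq (g x) 0; first by rewrite mulr0.
  suff : (supp f `&` supp g) x by rewrite dis.
  by split; apply: subset_closure.
Qed.

End MultiplicationOperator.

Theorem theorem1p2 (R : realType) (n : nat) (p q : R) :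
  (0 < n)%N -> 1 < p -> 1 < q -> q != 2 ->
  forall gamma : 'rV[R]_n -> R[i], schwartz gamma -> (exists x, gamma x != 0) ->
  exists T : ('rV[R]_n -> R[i]) -> ('rV[R]_n -> R[i]),
    CZ_operator T /\
    ~ (exists C : R, forall f : 'rV[R]_n -> R[i], schwartz f ->
         (modnorm gamma p q (T f) <= C%:E * modnorm gamma p q f)%E).
Proof.
case: n => [//|m] _ p1 q1 q2 gamma sg g0.
(* Defeating every natural number is a countable list of tasks, one for each hump; any real constant
   lies below one of them. *)
have [u [cu u1 Hu]] : exists u, [/\ ccontinuous u, forall y, cmod (u y) <= 1 &
    forall k : nat, defeats gamma p q k%:R u].
  apply: gliding_hump => k S kap kap0.
  have [ql|qg|qe] := ltgtP q 2; last by rewrite qe eqxx in q2.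
  - exact: defeating_step_lt2.
  - exact: defeating_step_gt2.
exists (mult u); split; first exact: CZ_operator_mult.
move=> [C HC]; have [f sf] := Hu (Num.truncn `|C|).+1; apply.
apply: le_trans (HC f sf) _; apply: lee_wpmul2r; first exact: poweR_ge0.
rewrite lee_fin (le_trans (ler_norm C)) // ltW //; exact: truncnS_gt.
Qed.
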